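(* There exist constants $C_{\tau,\delta}>0$ ($\tau>0$, $\delta>0$), depending only on $\tau$ and $\delta$, such that the following hold. (a) For all $\tau,\delta>0$, every $n\in L^1(\mathbb{R})$ with support $N$, and every $G\in\mathcal{B}_1(\tau)$, $$\|G\chi_N\|_1\le C_{\tau,\delta}\,\sup_{x\in\mathbb{R}}\bigl|N\cap[x,x+\delta]\bigr|\;\|G\|_1 .$$ (b) $C_{\tau,\delta}\le\frac{80}{13}\,(\tau+\delta^{-1})$ for all $\tau,\delta>0$. (c) $C_{\tau,\delta}\le\frac52\,(\tau+\delta^{-1})$ whenever $\tau\delta\ge2$. (d) $\displaystyle\lim_{\tau\delta\to\infty}\frac{C_{\tau,\delta}}{\tau+\delta^{-1}}=2$.
   Context: The Fourier transform is normalized by $\widehat{\varphi}(t)=\int\varphi(x)e^{-2\pi i xt}\,dx$. For $\tau>0$, $\mathcal{B}_1(\tau)$ denotes the Paley-Wiener space of all $G\in L^1(\mathbb{R})$ whose (distributional) Fourier transform is supported in $[-\tau,\tau]$. $|\cdot|$ denotes Lebesgue measure, $\chi_N$ is the characteristic function of $N$, and $\|\cdot\|_1$ is the $L^1(\mathbb{R})$ norm. The support of $n\in L^1(\mathbb{R})$ is understood as the measurable set $\{x: n(x)\neq0\}$ (determined up to null sets). The limit in (d) means: for every $\varepsilon>0$ there is $R$ such that the quotient differs from $2$ by less than $\varepsilon$ for all $\tau,\delta>0$ with $\tau\delta>R$. *)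

(* Defs.v *)
From HB Require Import structures.
From mathcomp Require Export all_boot all_order all_algebra.
From mathcomp Require Export all_classical all_reals all_analysis.
From mathcomp Require Export complex.

Set Implicit Arguments.
Unset Strict Implicit.
Unset Printing Implicit Defensive.

Import Order.TTheory GRing.Theory Num.Theory numFieldNormedType.Exports.
Local Open Scope classical_set_scope.
Local Open Scope ring_scope.

Section PaleyWiener.
Variable R : realType.
Local Notation mu := (@lebesgue_measure R).

(* Elements of L^1(R) are represented by actual functions, not by classes
   modulo null sets. *)
Definition L1 (f : R -> R[i]) : Prop :=
  mu.-integrable setT (fun x => (complex.Re (f x))%:E) /\
  mu.-integrable setT (fun x => (complex.Im (f x))%:E).

Definition L1norm (f : R -> R[i]) : \bar R :=
  Lnorm mu 1%E (fun x => (ComplexField.Normc.normc (f x))%:E).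

(* Meaningful when L1 f holds. *)
Definition cintegral (f : R -> R[i]) : R[i] :=
  Complex (\int[mu]_x (complex.Re (f x)))%R (\int[mu]_x (complex.Im (f x)))%R.

Definition cis (a : R) : R[i] := Complex (cos a) (sin a).

Definition fourier (f : R -> R[i]) (t : R) : R[i] :=
  cintegral (fun x => f x * cis (- (2 * pi * x * t))).

Definition smooth (f : R -> R) : Prop :=
  forall (n : nat) (x : R), derivable (derive1n n f) x 1.

Definition csupp (f : R -> R[i]) : set R := closure [set x | f x != 0].

(* C_c^oo(R), complex-valued. *)
Definition test_function (phi : R -> R[i]) : Prop :=
  [/\ smooth (fun x => complex.Re (phi x)),
      smooth (fun x => complex.Im (phi x)) &
      compact (csupp phi)].

(* The Fourier transform of G in L^1(R) as a (tempered) distribution: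
   <G^, phi> = <G, phi^>. *)
Definition fourier_dist (G : R -> R[i]) (phi : R -> R[i]) : R[i] :=
  cintegral (fun x => G x * fourier phi x).

(* A distribution is supported in the closed set K when it vanishes on the
   test functions whose support does not meet K. *)
Definition dist_supported (T : (R -> R[i]) -> R[i]) (K : set R) : Prop :=
  forall phi, test_function phi -> csupp phi `&` K = set0 -> T phi = 0.

Definition paley_wiener1 (tau : R) (G : R -> R[i]) : Prop :=
  L1 G /\ dist_supported (fourier_dist G) `[- tau, tau].

(* The support of an integrable function is a measurable set determined up to
   null sets; it is not closed up topologically. *)
Definition supp (f : R -> R[i]) : set R := [set x | f x != 0].

Definition window_density (N : set R) (delta : R) : \bar R :=
  ereal_sup (range (fun x : R => mu (N `&` `[x, x + delta]))).

End PaleyWiener.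

(* Main.v *)
Require Import Defs.
From mathcomp Require Import lra ring measurable_realfun.

(* The constant C = 2 tau + (7/2) / delta works.  Let V be the de la Vallee-Poussin kernel whose
   Fourier transform is the trapezoid equal to 1 on [-tau, tau] and to 0 outside
   [-tau - 1/delta, tau + 1/delta].  Then |V| <= 2 tau + 1/delta and |V(x)| <= delta / (4 x^2), so
   cutting the line into windows of length delta centred at y bounds the integral of |V(x - y)|
   over N by C times the window density of N.  A function G in the Paley-Wiener space satisfies
   G = V * G almost everywhere, and Tonelli's theorem gives (a); (b), (c), (d) are arithmetic.

   For G = V * G: testing against smooth bumps shows that the continuous Fourier transform of G
   vanishes off [-tau, tau].  Hence convolving G with V, or with a Poisson kernel of parameter a,
   amounts to multiplying the same compactly supported transform by weights that differ by O(a) on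
   [-tau, tau]; as a -> 0 the Poisson convolutions converge to G in integral over every segment, so
   G and V * G have the same integral over every segment. *)

Set Implicit Arguments.
Unset Strict Implicit.
Unset Printing Implicit Defensive.

Import Order.TTheory GRing.Theory Num.Theory numFieldNormedType.Exports.
Local Open Scope classical_set_scope.
Local Open Scope ring_scope.

(** * Smooth bump functions *)

Section FlatFunction.
Variable R : realType.
Implicit Types (p q : {poly R}) (x a b : R).

(** [flat 1] is the classical flat function exp(-1/x). The polynomial in 1/x is carried along so
    that the family is closed under differentiation. *)
Definition flat p x : R := if 0 < x then p.[x^-1] * expR (- x^-1) else 0.

(** For u >= 0 one has u^i <= i! exp u, so each monomial u^i times exp(-u) is at most i!. *)
Lemma horner_expRN_bounded p :
  exists M, forall u, 0 <= u -> `|p.[u] * expR (- u)| <= M.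
Proof.
exists (\sum_(i < size p) `|p`_i| * i`!%:R) => u u0.
rewrite horner_coef mulr_suml (le_trans (ler_norm_sum _ _ _))//.
apply: ler_sum => i _; rewrite -mulrA normrM ler_wpM2l//.
rewrite expRN ger0_norm ?divr_ge0 ?exprn_ge0 ?expR_ge0// ler_pdivrMr ?expR_gt0//.
case: (i : nat) => [|k]; first by rewrite expr0 fact0 mul1r -[leLHS]expR0 ler_expR.
rewrite mulrC -ler_pdivrMr ?ltr0n ?fact_gt0//.
by apply: le_trans (expR_ge1Dxn k u0); rewrite lerDr.
Qed.

Lemma flat_gt0 x : 0 < x -> 0 < flat 1 x.
Proof. by move=> x0; rewrite /flat x0 !hornerE expR_gt0. Qed.

Lemma flat_le0 p x : x <= 0 -> flat p x = 0.
Proof. by rewrite /flat leNgt => /negbTE ->. Qed.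

(** Away from 0 this is the chain rule, with the factor X^2 coming from the derivative of 1/x. At 0
    the derivative is 0 because exp(-1/h) beats every power of 1/h. *)
Lemma is_derive_flat p x : is_derive x 1 (flat p) (flat ('X^2 * (p - p^`())) x).
Proof.
have [x0|x0|->] := ltrgtP x 0.
- rewrite flat_le0 ?ltW//; apply: (@near_eq_is_derive _ _ _ (cst 0)).
    near=> y; rewrite flat_le0//= ltW//; near: y; exact: lt_nbhsl.
- rewrite [flat (_ * _) x]/flat x0.
  apply: (@near_eq_is_derive _ R^o R^o (fun y : R => p.[y^-1] * expR (- y^-1))).
    near=> y; rewrite /flat ifT//; near: y; exact: lt_nbhsr.
  have xn0 : x != 0 by rewrite gt_eqF.
  have dV : is_derive x (1 : R) (@GRing.inv R) (- x ^- 2).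
    have := is_deriveV xn0 (is_derive_id x (1 : R)).
    by rewrite [_ *: _]mulr1.
  have dN : is_derive x (1 : R) (fun y : R => - y^-1) (x ^- 2).
    by have := is_deriveN dV; rewrite opprK.
  have dp := is_derive1_comp (is_derive_poly p x^-1) dV.
  have de := @is_derive1_comp _ expR (fun y : R => - y^-1) x _ _ (is_derive_expR (- x^-1)) dN.
  apply: is_derive_eq (is_deriveM dp de) _.
  rewrite /= !hornerE /GRing.scale /= exprVn; ring.
- rewrite flat_le0//.
  have [M HM] := horner_expRN_bounded ('X^2 * p).
  have M0 : 0 <= M by apply: le_trans (HM 0 (lexx _)).
  suff H : (fun h => h^-1 *: (flat p (h + 0) - flat p 0)) @ 0^' --> (0 : R).
    apply: DeriveDef.
      apply/cvg_ex; exists 0; apply: cvg_trans H; apply: near_eq_cvg.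
      by near=> h; rewrite /= [h%:A]mulr1.
    by rewrite -derive1E; exact: cvg_lim.
  apply/cvgrPdist_le => e e0; near=> h.
  rewrite addr0 (@flat_le0 _ 0)// subr0 sub0r normrN /flat.
  case: ifPn => h0; last by rewrite scaler0 normr0 ltW.
  (* Trading 1/h for h times h^-2 puts the quotient in the form h times a bounded quantity. *)
  rewrite [_ *: _](_ : _ = h * (('X^2 * p).[h^-1] * expR (- h^-1))); last first.
    by rewrite !hornerE /GRing.scale /=; field; rewrite gt_eqF.
  rewrite normrM (@le_trans _ _ (`|h| * (M + 1)))//.
    by rewrite ler_wpM2l// (le_trans (HM _ _)) ?invr_ge0 ?ltW// ltrDl.
  rewrite -ler_pdivlMr ?ltr_wpDl//; near: h.
  apply: dnbhs0_le; rewrite divr_gt0// ltr_wpDl//.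
Unshelve. all: by end_near. Qed.

(* Closure under differentiation of the algebra generated by the functions [flat p]
   makes every element smooth. *)
Inductive flat_algebra a b : (R -> R) -> Prop :=
| flat_left p : flat_algebra a b (fun t => flat p (t - a))
| flat_right p : flat_algebra a b (fun t => flat p (b - t))
| flat_opp f : flat_algebra a b f -> flat_algebra a b (- f)
| flat_add f g : flat_algebra a b f -> flat_algebra a b g -> flat_algebra a b (f + g)
| flat_mul f g : flat_algebra a b f -> flat_algebra a b g -> flat_algebra a b (f * g).

Lemma flat_algebra_derive a b f : flat_algebra a b f ->
  exists2 g, flat_algebra a b g & forall x : R, is_derive x (1 : R) f (g x).
Proof.
elim => {f} [p|p|f _ [g Sg fg]|f h _ [f' Sf ff] _ [h' Sh hh]|f h Sf0 [f' Sf ff] Sh0 [h' Sh hh]].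
- exists (fun t => flat ('X^2 * (p - p^`())) (t - a)); first exact: flat_left.
  move=> x.
  have := @is_derive1_comp _ (flat p) (fun t : R => t - a) x _ _ (is_derive_flat p (x - a))
    (is_deriveB (is_derive_id x (1:R)) (is_derive_cst a x 1)).
  by rewrite subr0 mulr1.
- exists (- (fun t => flat ('X^2 * (p - p^`())) (b - t))); first exact/flat_opp/flat_right.
  move=> x.
  have := @is_derive1_comp _ (flat p) (fun t : R => b - t) x _ _ (is_derive_flat p (b - x))
    (is_deriveB (is_derive_cst b x 1) (is_derive_id x (1:R))).
  by rewrite sub0r mulrN1.
- by exists (- g); [exact: flat_opp|move=> x; exact: is_deriveN].
- by exists (f' + h'); [exact: flat_add|move=> x; exact: is_deriveD].
- exists (f * h' + h * f'); first by apply: flat_add; apply: flat_mul.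
  by move=> x; exact: is_deriveM.
Qed.

Lemma flat_algebra_smooth a b f : flat_algebra a b f -> smooth f.
Proof.
move=> Sf n; have : flat_algebra a b (derive1n n f).
  elim: n => // n /flat_algebra_derive[g Sg fg].
  rewrite derive1nS (_ : derive1 _ = g)//; apply/funext => x.
  by rewrite derive1E; have [_ ->] := fg x.
by move=> /flat_algebra_derive[g _ fg] x; have [] := fg x.
Qed.

Definition bump a b t := flat 1 (t - a) * flat 1 (b - t).

Lemma bump_smooth a b : smooth (bump a b).
Proof. exact: flat_algebra_smooth (flat_mul (flat_left a b 1) (flat_right a b 1)). Qed.

Lemma bump_ge0 a b t : 0 <= bump a b t.
Proof.
by rewrite /bump /flat !hornerE; apply: mulr_ge0; case: ifP => // _; exact: expR_ge0.
Qed.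

Lemma bump_gt0 a b t : a < t < b -> 0 < bump a b t.
Proof. by move=> /andP[at1 tb]; rewrite mulr_gt0// flat_gt0// subr_gt0. Qed.

Lemma bump_eq0 a b t : ~~ (a < t < b) -> bump a b t = 0.
Proof.
rewrite negb_and -!leNgt => /orP[ta|bt]; rewrite /bump.
  by rewrite (@flat_le0 _ (t - a)) ?mul0r// subr_le0.
by rewrite (@flat_le0 _ (b - t)) ?mulr0// subr_le0.
Qed.

Lemma bump_continuous a b : continuous (bump a b).
Proof.
move=> x; apply/differentiable_continuous/derivable1_diffP.
exact: (@bump_smooth a b 0%N x).
Qed.

Lemma bump_le1 a b t : bump a b t <= 1.
Proof.
have flat1 x : 0 <= flat 1 x <= 1.
  rewrite /flat !hornerE; case: ifPn => x0; last by rewrite lexx ler01.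
  by rewrite expR_ge0 expR_le1 oppr_le0 invr_ge0 ltW.
by rewrite /bump mulr_ile1//; have /andP[] := flat1 (t - a); have /andP[] := flat1 (b - t).
Qed.

Lemma bump_test_function a b :
  test_function (fun t => Complex (bump a b t) 0) /\
  csupp (fun t => Complex (bump a b t) 0) `<=` `[a, b].
Proof.
have sub : csupp (fun t => Complex (bump a b t) 0) `<=` `[a, b].
  rewrite /csupp; apply: (@subset_trans _ (closure `[a, b])); last first.
    by rewrite -(closure_id _).1; [|exact: itv_closed].
  apply: closure_subset => t /=.
  apply: contra_neqP; rewrite in_itv /= => /negP tab; rewrite bump_eq0//.
  by apply: contra tab => /andP[/ltW -> /ltW ->].
split=> //; split => /=.
- exact: bump_smooth.
- move=> n x; have -> : derive1n n (fun _ : R => 0 : R) = cst 0.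
    elim: n => // n IH; rewrite derive1nS IH; apply/funext => y.
    by rewrite derive1_cst.
  exact: derivable_cst.
- by apply: subclosed_compact (@segment_compact _ a b) sub; exact: closed_closure.
Qed.

End FlatFunction.

(** * Integrals of products and cosine transforms *)

Section Swap.
Variable R : realType.
Local Notation mu := (@lebesgue_measure R).
Implicit Types (g w : R -> R) (M : R).

Lemma measurable_real_fun g : mu.-integrable setT (EFin \o g) -> measurable_fun setT g.
Proof. by move=> /integrableP[/measurable_EFinP]. Qed.

Lemma integrable_mul_bounded g (h : R -> R) M : mu.-integrable setT (EFin \o g) ->
  measurable_fun setT h -> (forall x, `|h x| <= M) ->
  mu.-integrable setT (EFin \o (fun x => g x * h x)).
Proof.
move=> ig mh hM; have := integrableMl measurableT ig mh; apply.
exists M; split; first by rewrite num_real.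
by move=> N MN x _ /=; rewrite (le_trans (hM x))// ltW.
Qed.

Lemma normr_integral_mul_bounded g (h : R -> R) M : mu.-integrable setT (EFin \o g) ->
  measurable_fun setT h -> (forall x, `|h x| <= M) ->
  `|\int[mu]_x (g x * h x)| <= M * \int[mu]_x `|g x|.
Proof.
move=> ig mh hM; have igh := integrable_mul_bounded ig mh hM.
rewrite (le_trans (le_normr_Rintegral _ igh))//.
have ing : mu.-integrable setT (EFin \o (fun x => `|g x|)) by exact: integrable_norm.
rewrite -RintegralZl//; apply: le_Rintegral => //.
- exact: integrable_norm.
- by have := integrableZl measurableT M ing.
- by move=> x _ /=; rewrite normrM mulrC ler_wpM2r.
Qed.

Lemma Rintegral_indicM (A : set R) g :
  \int[mu]_(x in A) g x = \int[mu]_x (\1_A x * g x).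
Proof.
rewrite Rintegral_mkcond; apply: eq_Rintegral => x _.
by rewrite patchE indicE; case: (x \in A); rewrite ?mul1r ?mul0r.
Qed.

Variables (g w : R -> R) (k : R * R -> R) (M : R).
Hypotheses (ig : mu.-integrable setT (EFin \o g)) (iw : mu.-integrable setT (EFin \o w)).
Hypotheses (mk : measurable_fun setT k) (kM : forall z, `|k z| <= M).

Let mk1 x : measurable_fun setT (fun t => k (x, t)).
Proof. exact: measurableT_comp mk (measurable_pair1 x). Qed.

Let mk2 t : measurable_fun setT (fun x => k (x, t)).
Proof. exact: measurableT_comp mk (measurable_pair2 t). Qed.

Let f (z : R * R) := (g z.1 * (w z.2 * k z))%:E.

(** By Tonelli it is enough that the iterated integral of |f| is finite; it is at most M times the
    product of the L1 norms of g and w. *)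
Let f_integrable : (mu \x mu)%E.-integrable setT f.
Proof.
have mf : measurable_fun setT f.
  apply/measurable_EFinP; apply: measurable_funM.
    exact: measurableT_comp (measurable_real_fun ig) measurable_fst.
  apply: measurable_funM => //.
  exact: measurableT_comp (measurable_real_fun iw) measurable_snd.
apply/integrable12ltyP => //.
have M0 : 0 <= M by exact: le_trans (normr_ge0 _) (kM (0, 0)).
have iE (h : R -> R) : mu.-integrable setT (EFin \o h) ->
    (\int[mu]_t `|h t|%:E)%E = (\int[mu]_t `|h t|)%:E.
  by move=> ih; rewrite /Rintegral fineK// integrable_fin_num//; exact: integrable_norm.
apply: (@le_lt_trans _ _ (\int[mu]_x (`|g x| * (M * \int[mu]_t `|w t|))%:E)%E).
  apply: ge0_le_integral => //.
  - by move=> x _; exact: integral_ge0.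
  - have maf : measurable_fun setT (abse \o f) by exact: measurableT_comp.
    exact: (@measurable_fun_fubini_tonelli_F _ _ _ _ _ mu (abse \o f) maf
      (fun z => abse_ge0 (f z))).
  - apply/measurable_EFinP; apply: measurable_funM => //.
    by apply: measurableT_comp => //; exact: measurable_real_fun.
  move=> x _; rewrite EFinM.
  rewrite (_ : (fun y => _) = (fun y => `|g x|%:E * `|w y * k (x, y)|%:E)%E); last first.
    by apply/funext => y; rewrite /f /= normrM.
  rewrite ge0_integralZl//; last first.
  - apply/measurable_EFinP; apply: measurableT_comp => //.
    apply: measurable_funM; [exact: measurable_real_fun iw|exact: mk1].
  rewrite lee_wpmul2l//.
  have iwk := integrable_mul_bounded iw (mk1 x) (fun t => kM (x, t)).
  rewrite iE// lee_fin.
  have inw : mu.-integrable setT (EFin \o (fun x => `|w x|)) by exact: integrable_norm.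
  rewrite -RintegralZl//; apply: le_Rintegral => //.
  - exact: integrable_norm.
  - by have := integrableZl measurableT M inw.
  - by move=> t _ /=; rewrite normrM mulrC ler_wpM2r.
under eq_integral do rewrite EFinM muleC.
rewrite ge0_integralZl//; last 2 first.
- apply/measurable_EFinP; apply: measurableT_comp => //; exact: measurable_real_fun.
- by rewrite lee_fin mulr_ge0// Rintegral_ge0.
by rewrite iE// -EFinM ltry.
Qed.

Let inner1 x : (\int[mu]_t f (x, t))%E = (g x * \int[mu]_t (w t * k (x, t)))%:E.
Proof.
have iwk := integrable_mul_bounded iw (mk1 x) (fun t => kM (x, t)).
rewrite -RintegralZl// /Rintegral fineK//.
exact: (integrable_fin_num _ (integrableZl measurableT (g x) iwk)).
Qed.

Let inner2 t : (\int[mu]_x f (x, t))%E = (w t * \int[mu]_x (g x * k (x, t)))%:E.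
Proof.
have iwk := integrable_mul_bounded ig (mk2 t) (fun x => kM (x, t)).
rewrite -RintegralZl// /Rintegral fineK//.
  by apply: eq_integral => x _; rewrite /f /= mulrCA.
exact: (integrable_fin_num _ (integrableZl measurableT (w t) iwk)).
Qed.

(** Fubini for a bounded kernel k between two integrable functions. It yields the multiplication
    formulas, the frequency form of a convolution and the integral of a Poisson convolution over a
    segment. *)
Lemma Rintegral_swap :
  \int[mu]_x (g x * \int[mu]_t (w t * k (x, t))) =
  \int[mu]_t (w t * \int[mu]_x (g x * k (x, t))).
Proof.
rewrite /Rintegral; congr fine.
transitivity (\int[mu]_x \int[mu]_t f (x, t))%E.
  by apply: eq_integral => x _; rewrite inner1.
rewrite (Fubini f_integrable); apply: eq_integral => t _; exact: inner2.
Qed.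

End Swap.

(** * Cosine and sine transforms, and detecting zeros with bumps *)

Section Transforms.
Variable R : realType.
Local Notation mu := (@lebesgue_measure R).
Implicit Types (g w : R -> R) (M : R).

(** Continuity under the integral sign, with M |g| as dominating function. It serves both the
    transforms and the convolutions. *)
Lemma continuous_integral_param g (k : R -> R -> R) M :
  mu.-integrable setT (EFin \o g) ->
  (forall y, continuous (k ^~ y)) -> (forall x, measurable_fun setT (k x)) ->
  (forall x y, `|k x y| <= M) ->
  continuous (fun x => \int[mu]_y (g y * k x y)).
Proof.
move=> ig ck mk kM x.
have ing : mu.-integrable setT (EFin \o (fun y => M * `|g y|)).
  by have := integrableZl measurableT M (integrable_norm ig).
apply: (@continuity_under_integral R _ _ mu (fun x y => g y * k x y) setT measurableT
  (x - 1) (x + 1) _ _ (fun y => M * `|g y|) ing).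
- by move=> z _; exact: integrable_mul_bounded ig (mk z) (kM z).
- by apply: aeW => y _ z _; apply: cvgM; [exact: cvg_cst|exact: ck].
- by move=> z _; apply: aeW => y _; rewrite normrM mulrC ler_wpM2r.
- by rewrite inE /= in_itv /= ltrBlDr !ltrDl ltr01.
Qed.

(** For real g the Fourier transform is [cos_transform g] - i [sin_transform g]; this splitting
    keeps the later integrals real. *)
Definition cos_transform g t := \int[mu]_x (g x * cos (2 * pi * t * x)).
Definition sin_transform g t := \int[mu]_x (g x * sin (2 * pi * t * x)).

Lemma continuous_phase (c : R) (h : R -> R) : continuous h -> continuous (fun x => h (c * x)).
Proof.
move=> ch x; apply: (@continuous_comp _ _ _ ( *%R c) h); last exact: ch.
by apply: cvgM; [exact: cvg_cst|exact: cvg_id].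
Qed.

Lemma measurable_phase (h : R -> R) : continuous h ->
  measurable_fun setT (fun z : R * R => h (2 * pi * z.2 * z.1)).
Proof.
move=> ch; apply: (measurableT_comp (continuous_measurable_fun ch)).
apply: measurable_funM => //; exact: measurable_funM.
Qed.

Lemma continuous_cos_transform g : mu.-integrable setT (EFin \o g) ->
  continuous (cos_transform g).
Proof.
move=> ig; apply: (@continuous_integral_param g (fun t x => cos (2 * pi * t * x)) 1) => //.
- move=> y; rewrite (_ : (fun _ => _) = (fun t => cos (2 * pi * y * t))).
    exact: continuous_phase (@continuous_cos R).
  by apply/funext => t; rewrite mulrAC.
- by move=> x; apply: continuous_measurable_fun; exact: continuous_phase (@continuous_cos R).
- by move=> x y; exact: cos_max.
Qed.

Lemma continuous_sin_transform g : mu.-integrable setT (EFin \o g) ->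
  continuous (sin_transform g).
Proof.
move=> ig; apply: (@continuous_integral_param g (fun t x => sin (2 * pi * t * x)) 1) => //.
- move=> y; rewrite (_ : (fun _ => _) = (fun t => sin (2 * pi * y * t))).
    exact: continuous_phase (@continuous_sin R).
  by apply/funext => t; rewrite mulrAC.
- by move=> x; apply: continuous_measurable_fun; exact: continuous_phase (@continuous_sin R).
- by move=> x y; exact: sin_max.
Qed.

Lemma cos_transformN g t : cos_transform g (- t) = cos_transform g t.
Proof. by apply: eq_Rintegral => x _; rewrite mulrN mulNr cosN. Qed.

Lemma sin_transformN g t : mu.-integrable setT (EFin \o g) ->
  sin_transform g (- t) = - sin_transform g t.
Proof.
move=> ig; rewrite /sin_transform -[RHS]mulN1r -RintegralZl//.
  by apply: eq_Rintegral => x _; rewrite mulrN mulNr sinN mulrN mulN1r.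
apply: (@integrable_mul_bounded _ _ _ 1 ig) => [|x]; last exact: sin_max.
apply: continuous_measurable_fun; exact: continuous_phase (@continuous_sin R).
Qed.

(** By continuity f is at least f(t0)/2 on an open interval around t0, which already contributes a
    positive amount. *)
Lemma integral_gt0 (f : R -> R) t0 : (forall t, 0 <= f t) -> continuous f ->
  mu.-integrable setT (EFin \o f) -> 0 < f t0 -> 0 < \int[mu]_t f t.
Proof.
move=> f0 cf intf ft0.
have /cvgrPdist_lt /(_ _ (divr_gt0 ft0 (ltr0n _ 2))) := cf t0.
move=> /nbhs_ballP[e /= e0 He].
have sub t : t \in `]t0 - e, t0 + e[ -> f t0 / 2 <= f t.
  rewrite in_itv /= => /andP[t1 t2].
  have : `|f t0 - f t| < f t0 / 2.
    by apply: He; rewrite /ball /= ltr_distlC t1 t2.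
  by rewrite ltr_norml => /andP[_]; lra.
pose I := `]t0 - e, t0 + e[%classic.
have mI : measurable I by exact: measurable_itv.
rewrite /Rintegral fine_gt0//; apply/andP; split; last first.
  by have /integral_fune_lt_pinfty := intf; apply.
apply: (@lt_le_trans _ _ (\int[mu]_(t in I) (f t0 / 2)%:E)%E).
  rewrite integral_cst//.
  have muI : mu I = (e *+ 2)%:E.
    rewrite lebesgue_measure_itv /= lte_fin ifT; last by lra.
    by rewrite -EFinD; congr EFin; ring.
  by rewrite [X in (_ * X)%E]muI -EFinM lte_fin mulr_gt0 ?divr_gt0// pmulrn_lgt0.
apply: (@le_trans _ _ (\int[mu]_(t in I) (f t)%:E)%E).
  apply: ge0_le_integral => //.
  - by move=> t _; rewrite lee_fin divr_ge0// ltW.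
  - apply/measurable_EFinP; apply: measurable_funTS; exact: continuous_measurable_fun.
apply: ge0_subset_integral => //.
- by apply/measurable_EFinP; exact: continuous_measurable_fun.
- by move=> t _; rewrite lee_fin.
Qed.

Lemma integrable_bump a b : mu.-integrable setT (EFin \o bump a b).
Proof.
apply: (@le_integrable _ _ _ mu setT measurableT _ (EFin \o \1_`[a, b])).
- by apply/measurable_EFinP; apply: continuous_measurable_fun; exact: bump_continuous.
- move=> t _; rewrite /= lee_fin !ger0_norm ?bump_ge0//.
  case: (boolP (a < t < b)) => [tab|/bump_eq0 -> //].
  rewrite indicE mem_set ?bump_le1//= in_itv /=.
  by case/andP: tab => /ltW -> /ltW ->.
- exact: integrable_indic_itv.
Qed.

(** The fundamental lemma of the calculus of variations: if A(t0) were nonzero, A would keep its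
    sign near t0, and a bump concentrated there would have a nonzero integral against A. *)
Lemma bump_test_eq0 (A : R -> R) M (U : set R) :
  open U -> continuous A -> (forall t, `|A t| <= M) ->
  (forall a b, `[a, b] `<=` U -> \int[mu]_t (bump a b t * A t) = 0) ->
  forall t, U t -> A t = 0.
Proof.
move=> oU cA AM HA t0 Ut0; apply/eqP; apply: contraT => At0.
pose s := Num.sg (A t0).
have cs : continuous (fun t => s * A t).
  by move=> t; apply: cvgM; [exact: cvg_cst|exact: cA].
have s0 : 0 < s * A t0 by rewrite -normrEsg normr_gt0.
have : \forall t \near t0, U t /\ 0 < s * A t.
  near=> t; split; first by near: t; exact: open_nbhs_nbhs.
  by near: t; exact: (cvgr_gt _ (cs t0)).
move=> /nbhs_ballP[e /= e0 He].
have He' t : t0 - e < t < t0 + e -> U t /\ 0 < s * A t.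
  by move=> te; apply: He; rewrite /ball /= ltr_distlC.
(* Half the radius is used so that the closed segment carrying the bump stays inside the open
   ball. *)
have := HA (t0 - e / 2) (t0 + e / 2); move=> HA'.
have Z : \int[mu]_t (bump (t0 - e / 2) (t0 + e / 2) t * A t) = 0.
  apply: HA' => t /=; rewrite in_itv /= => /andP[t1 t2].
  have te : t0 - e < t < t0 + e by apply/andP; split; lra.
  by have [] := He' t te.
pose f t := s * (bump (t0 - e / 2) (t0 + e / 2) t * A t).
have ib : mu.-integrable setT (EFin \o (fun t => bump (t0 - e / 2) (t0 + e / 2) t * A t)).
  apply: integrable_mul_bounded AM; first exact: integrable_bump.
  exact: continuous_measurable_fun.
suff : 0 < \int[mu]_t f t by rewrite /f RintegralZl// Z mulr0 ltxx.
apply: (@integral_gt0 _ t0).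
- move=> t; rewrite /f mulrCA.
  case: (boolP (t0 - e / 2 < t < t0 + e / 2)) => [tb|/bump_eq0 ->]; last by rewrite mul0r.
  have te : t0 - e < t < t0 + e by case/andP: tb => t1 t2; apply/andP; split; lra.
  by rewrite mulr_ge0 ?bump_ge0//; have [_ /ltW] := He' t te.
- move=> t; rewrite /f; apply: cvgM; first exact: cvg_cst.
  by apply: cvgM; [exact: bump_continuous|exact: cA].
- exact: (integrableZl measurableT s ib).
- by rewrite /f mulrCA mulr_gt0// bump_gt0//; lra.
Unshelve. all: by end_near. Qed.

End Transforms.

(** * Vanishing of the continuous Fourier transform outside the spectrum *)

Section PaleyWienerTransforms.
Variable R : realType.
Local Notation mu := (@lebesgue_measure R).
Implicit Types (g w : R -> R).

Lemma ReM (x y : R[i]) : complex.Re (x * y) =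
  complex.Re x * complex.Re y - complex.Im x * complex.Im y.
Proof. by case: x y => [a b] [c d]. Qed.

Lemma ImM (x y : R[i]) : complex.Im (x * y) =
  complex.Re x * complex.Im y + complex.Im x * complex.Re y.
Proof. by case: x y => [a b] [c d]. Qed.

Lemma fourier_real g x : mu.-integrable setT (EFin \o g) ->
  fourier (fun t => Complex (g t) 0) x = Complex (cos_transform g x) (- sin_transform g x).
Proof.
move=> ig; rewrite /fourier /cintegral -sin_transformN//; congr Complex; apply: eq_Rintegral => t _.
  by rewrite ReM /= mul0r subr0 cosN; congr (_ * cos _); ring.
by rewrite ImM /= mul0r addr0; congr (_ * sin _); ring.
Qed.

(** The cosine half of the multiplication formula, which moves the transform from one factor to the
    other; the symmetric phase makes both sides transforms. *)
Lemma cos_transform_swap g w :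
  mu.-integrable setT (EFin \o g) -> mu.-integrable setT (EFin \o w) ->
  \int[mu]_x (g x * cos_transform w x) = \int[mu]_t (w t * cos_transform g t).
Proof.
move=> ig iw; rewrite /cos_transform.
have := Rintegral_swap ig iw (measurable_phase (@continuous_cos R)) (fun z => cos_max _).
move=> /= <-; apply: eq_Rintegral => x _; congr (_ * _).
by apply: eq_Rintegral => t _; rewrite mulrAC.
Qed.

Lemma sin_transform_swap g w :
  mu.-integrable setT (EFin \o g) -> mu.-integrable setT (EFin \o w) ->
  \int[mu]_x (g x * sin_transform w x) = \int[mu]_t (w t * sin_transform g t).
Proof.
move=> ig iw; rewrite /sin_transform.
have := Rintegral_swap ig iw (measurable_phase (@continuous_sin R)) (fun z => sin_max _).
move=> /= <-; apply: eq_Rintegral => x _; congr (_ * _).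
by apply: eq_Rintegral => t _; rewrite mulrAC.
Qed.

Lemma cos_transform_bound g t : mu.-integrable setT (EFin \o g) ->
  `|cos_transform g t| <= \int[mu]_x `|g x|.
Proof.
move=> ig; rewrite -[leRHS]mul1r; apply: normr_integral_mul_bounded => //.
  by apply: continuous_measurable_fun; exact: continuous_phase (@continuous_cos R).
by move=> x; exact: cos_max.
Qed.

Lemma sin_transform_bound g t : mu.-integrable setT (EFin \o g) ->
  `|sin_transform g t| <= \int[mu]_x `|g x|.
Proof.
move=> ig; rewrite -[leRHS]mul1r; apply: normr_integral_mul_bounded => //.
  by apply: continuous_measurable_fun; exact: continuous_phase (@continuous_sin R).
by move=> x; exact: sin_max.
Qed.

Lemma integrable_mul_transform g (A : R -> R) M : mu.-integrable setT (EFin \o g) ->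
  continuous A -> (forall t, `|A t| <= M) -> mu.-integrable setT (EFin \o (fun t => g t * A t)).
Proof.
by move=> ig cA AM; apply: integrable_mul_bounded AM => //; exact: continuous_measurable_fun.
Qed.

Variables (tau : R) (G : R -> R[i]).
Hypothesis PW : paley_wiener1 tau G.
Let g1 x := complex.Re (G x).
Let g2 x := complex.Im (G x).
Let i1 : mu.-integrable setT (EFin \o g1). Proof. by case: PW => -[]. Qed.
Let i2 : mu.-integrable setT (EFin \o g2). Proof. by case: PW => -[]. Qed.
Let U := ~` `[- tau, tau]%classic : set R.
Let oU : open U. Proof. by apply: closed_openC; exact: itv_closed. Qed.

Let UE t : tau < `|t| -> U t.
Proof.
move=> tt; rewrite /U /= in_itv /= => /andP[t1 t2].
by move: tt; rewrite ltNge ler_norml t1 t2.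
Qed.

(** [A] and [B] are the real and imaginary parts of the Fourier transform of G. *)
Let A t := cos_transform g1 t + sin_transform g2 t.
Let B t := cos_transform g2 t - sin_transform g1 t.

(** A bump on [a, b] is a test function whose support misses [-tau, tau], so the distributional
    transform vanishes on it. Taking real and imaginary parts and applying the multiplication
    formula puts the transform on G. *)
Let dist a b : `[a, b] `<=` U ->
  \int[mu]_t (bump a b t * A t) = 0 /\ \int[mu]_t (bump a b t * B t) = 0.
Proof.
move=> abU; have ib := integrable_bump a b.
have [tf cs] := bump_test_function a b.
have := PW.2 _ tf; have -> : csupp (fun t => Complex (bump a b t) 0) `&` `[- tau, tau] = set0.
  by rewrite -subset0 => t [/cs/abU].
move=> /(_ erefl); rewrite /fourier_dist /cintegral.
have cc (g : R -> R) : mu.-integrable setT (EFin \o g) ->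
    mu.-integrable setT (EFin \o (fun x => g x * cos_transform (bump a b) x)).
  move=> ig; apply: integrable_mul_transform => //; first exact: continuous_cos_transform.
  by move=> t; exact: cos_transform_bound.
have cb (g : R -> R) : mu.-integrable setT (EFin \o g) ->
    mu.-integrable setT (EFin \o (fun x => bump a b x * cos_transform g x)).
  move=> ig; apply: integrable_mul_transform => //; first exact: continuous_cos_transform.
  by move=> t; exact: cos_transform_bound.
have sc (g : R -> R) : mu.-integrable setT (EFin \o g) ->
    mu.-integrable setT (EFin \o (fun x => g x * sin_transform (bump a b) x)).
  move=> ig; apply: integrable_mul_transform => //; first exact: continuous_sin_transform.
  by move=> t; exact: sin_transform_bound.
have sb (g : R -> R) : mu.-integrable setT (EFin \o g) ->
    mu.-integrable setT (EFin \o (fun x => bump a b x * sin_transform g x)).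
  move=> ig; apply: integrable_mul_transform => //; first exact: continuous_sin_transform.
  by move=> t; exact: sin_transform_bound.
move=> [ReE ImE]; split.
  under eq_Rintegral do rewrite mulrDr.
  rewrite RintegralD//; [|exact: cb|exact: sb].
  rewrite -cos_transform_swap// -sin_transform_swap// -RintegralD//; [|exact: cc|exact: sc].
  rewrite -[RHS]ReE; apply: eq_Rintegral => x _.
  by rewrite ReM fourier_real//= mulrN opprK.
under eq_Rintegral do rewrite mulrBr.
rewrite RintegralB//; [|exact: cb|exact: sb].
rewrite -cos_transform_swap// -sin_transform_swap// -RintegralB//; [|exact: cc|exact: sc].
rewrite -[RHS]ImE; apply: eq_Rintegral => x _.
by rewrite ImM fourier_real//= mulrN addrC.
Qed.

Let norms := \int[mu]_x `|g1 x| + \int[mu]_x `|g2 x|.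

Let A0 t : tau < `|t| -> A t = 0.
Proof.
move=> /UE Ut; apply: (@bump_test_eq0 _ A norms U oU) => //.
- by move=> x; apply: cvgD; [exact: continuous_cos_transform|exact: continuous_sin_transform].
- move=> x; rewrite (le_trans (ler_normD _ _))// lerD//; first exact: cos_transform_bound.
  exact: sin_transform_bound.
- by move=> a b /dist[].
Qed.

Let B0 t : tau < `|t| -> B t = 0.
Proof.
move=> /UE Ut; apply: (@bump_test_eq0 _ B norms U oU) => //.
- by move=> x; apply: cvgB; [exact: continuous_cos_transform|exact: continuous_sin_transform].
- move=> x; rewrite /norms [leRHS]addrC (le_trans (ler_normB _ _))// lerD//.
    exact: cos_transform_bound.
  exact: sin_transform_bound.
- by move=> a b /dist[].
Qed.

(** [A] and [B] vanish at both t and -t. As cosine transforms are even and sine transforms odd,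
    these four linear equations separate the four unknowns, so the real and imaginary parts of G can
    be treated as two real functions. *)
Lemma paley_wiener_transforms t : tau < `|t| ->
  [/\ cos_transform g1 t = 0, sin_transform g1 t = 0,
      cos_transform g2 t = 0 & sin_transform g2 t = 0].
Proof.
move=> tt; have := A0 tt; have := B0 tt.
have tN : tau < `|- t| by rewrite normrN.
have := A0 tN; have := B0 tN; rewrite /A /B !cos_transformN !sin_transformN//.
by move=> h1 h2 h3 h4; split; lra.
Qed.

End PaleyWienerTransforms.

(** * Explicit kernels *)

Section Kernels.
Variable R : realType.
Local Notation mu := (@lebesgue_measure R).
Implicit Types (g w f F : R -> R) (a b : R).

Lemma is_derive_continuous F f : (forall x : R, is_derive x (1 : R) F (f x)) -> continuous F.
Proof. by move=> dF x; apply/differentiable_continuous/derivable1_diffP; case: (dF x). Qed.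

Lemma Rintegral_FTC2 f F a b : a < b -> continuous f ->
  (forall x : R, is_derive x (1 : R) F (f x)) ->
  \int[mu]_(x in `[a, b]) f x = F b - F a.
Proof.
move=> ab cf dF; have cF := is_derive_continuous dF.
rewrite /Rintegral (@continuous_FTC2 _ f F a b) //.
- exact: continuous_subspaceT.
- split; first by move=> x _; case: (dF x).
  + by apply: cvg_at_right_filter; exact: cF.
  + by apply: cvg_at_left_filter; exact: cF.
- by move=> x _; rewrite derive1E; case: (dF x) => _ ->.
Qed.

Lemma is_derive_expM (c t : R) : is_derive t (1 : R) (fun t => expR (c * t)) (c * expR (c * t)).
Proof.
apply: is_derive_eq (@is_derive1_comp _ expR ( *%R c) t _ _ (is_derive_expR _)
  (is_deriveZ c (is_derive_id t (1 : R)))) _.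
by rewrite /GRing.scale /= mulr1 mulrC.
Qed.

Lemma is_derive_cosM (c t : R) : is_derive t (1 : R) (fun t => cos (c * t)) (- c * sin (c * t)).
Proof.
apply: is_derive_eq (@is_derive1_comp _ cos ( *%R c) t _ _ (is_derive_cos _)
  (is_deriveZ c (is_derive_id t (1 : R)))) _.
by rewrite /GRing.scale /= mulr1 mulrC mulrN mulNr.
Qed.

Lemma is_derive_sinM (c t : R) : is_derive t (1 : R) (fun t => sin (c * t)) (c * cos (c * t)).
Proof.
apply: is_derive_eq (@is_derive1_comp _ sin ( *%R c) t _ _ (is_derive_sin _)
  (is_deriveZ c (is_derive_id t (1 : R)))) _.
by rewrite /GRing.scale /= mulr1 mulrC.
Qed.

(** The right half of the even triangle of height S on [-S, S]; the Fourier transform of the whole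
    triangle is twice the cosine transform of this half. *)
Definition triangle (S : R) : R -> R := (fun t => S - t) \_ `[0, S].

Lemma integrable_restrict_segment f a b : continuous f ->
  mu.-integrable setT (EFin \o (f \_ `[a, b])).
Proof.
move=> cf; rewrite -restrict_EFin.
have := continuous_compact_integrable (@segment_compact _ a b) (continuous_subspaceT cf).
by apply: (iffLR (integrable_mkcond _ _)); exact: measurable_itv.
Qed.

Lemma integrable_triangle S : mu.-integrable setT (EFin \o triangle S).
Proof.
apply: integrable_restrict_segment => x; apply: cvgB; first exact: cvg_cst.
exact: cvg_id.
Qed.

Lemma cos_transform_restrict f (D : set R) x :
  cos_transform (f \_ D) x = \int[mu]_(t in D) (f t * cos (2 * pi * x * t)).
Proof.
rewrite [RHS]Rintegral_mkcond; apply: eq_Rintegral => t _.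
by rewrite !patchE; case: ifP => // _; rewrite mul0r.
Qed.

Lemma cos_transform_triangle0 S : 0 < S -> cos_transform (triangle S) 0 = S ^+ 2 / 2.
Proof.
move=> S0; rewrite cos_transform_restrict.
under eq_Rintegral do rewrite mulr0 mul0r cos0 mulr1.
have dF (t : R) : is_derive t (1 : R) (fun t => S * t - 2^-1 * t ^+ 2) (S - t).
  have d1 := is_deriveZ S (is_derive_id t (1 : R)).
  have d2 := is_deriveZ 2^-1 (is_deriveX 2 (is_derive_id t (1 : R))).
  apply: is_derive_eq (is_deriveB d1 d2) _.
  by rewrite /GRing.scale /= !mulr1 expr1; field.
have cf : continuous (fun t => S - t).
  by move=> x; apply: cvgB; [exact: cvg_cst|exact: cvg_id].
by rewrite (Rintegral_FTC2 S0 cf dF); field.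
Qed.

(** Half a Fejer kernel, computed with an antiderivative found by integrating by parts. *)
Lemma cos_transform_triangle S x : 0 < S -> x != 0 ->
  cos_transform (triangle S) x = (1 - cos (2 * pi * S * x)) / (2 * pi * x) ^+ 2.
Proof.
move=> S0 x0; rewrite cos_transform_restrict.
set b := 2 * pi * x.
have b0 : b != 0 by rewrite !mulf_neq0// gt_eqF// pi_gt0.
have dF (t : R) : is_derive t (1 : R)
    (fun t => (S - t) * (b^-1 * sin (b * t)) - b ^- 2 * cos (b * t))
    ((S - t) * cos (b * t)).
  have d1 := is_deriveM (is_deriveB (is_derive_cst S t 1) (is_derive_id t (1 : R)))
    (is_deriveZ b^-1 (is_derive_sinM b t)).
  have d2 := is_deriveZ (b ^- 2) (is_derive_cosM b t).
  apply: is_derive_eq (is_deriveB d1 d2) _.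
  by rewrite !fctE /= /GRing.scale /=; field.
have cf : continuous (fun t => (S - t) * cos (b * t)).
  move=> t; apply: cvgM; last exact: continuous_phase (@continuous_cos R) t.
  by apply: cvgB; [exact: cvg_cst|exact: cvg_id].
rewrite (Rintegral_FTC2 S0 cf dF) subrr mul0r !mulr0 sin0 cos0 (_ : b * S = 2 * pi * S * x).
  by field.
by rewrite /b; ring.
Qed.

Lemma cos_transform_exponential a x : 0 < a ->
  cos_transform (exponential_pdf a) x = a ^+ 2 / (a ^+ 2 + (2 * pi * x) ^+ 2).
Proof.
move=> a0; set b := 2 * pi * x.
have D0 : a ^+ 2 + b ^+ 2 != 0 by rewrite gt_eqF// ltr_pwDl ?exprn_gt0// sqr_ge0.
have ie := integrable_exponential_pdf a0.
have ic : mu.-integrable setT (EFin \o (fun t => exponential_pdf a t * cos (b * t))).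
  apply: (@integrable_mul_bounded _ _ _ 1 ie) => [|t]; last exact: cos_max.
  by apply: continuous_measurable_fun; exact: continuous_phase (@continuous_cos R).
have I1 : \int[mu]_t exponential_pdf a t = 1.
  by rewrite /Rintegral integral_exponential_pdf.
(* The fundamental theorem on a half-line is applied to a nonnegative integrand, so 1 + cos replaces
   cos; the added 1 contributes the total mass 1 of the density. *)
have : \int[mu]_t (exponential_pdf a t + exponential_pdf a t * cos (b * t)) =
    1 + a ^+ 2 / (a ^+ 2 + b ^+ 2).
  transitivity (\int[mu]_(t in `[0, +oo[) (a * expR (- a * t) * (1 + cos (b * t)))).
    rewrite [RHS]Rintegral_mkcond; apply: eq_Rintegral => t _.
    by rewrite /exponential_pdf !patchE; case: ifP => // _; rewrite ?mul0r ?addr0 ?mulrDr ?mulr1.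
  (* This antiderivative tends to 0 at infinity, so the integral is -F(0). *)
  pose F t := expR (- a * t) *
    ((a ^+ 2 + b ^+ 2)^-1 * (a * (b * sin (b * t) - a * cos (b * t))) - 1).
  have dF t : is_derive t (1 : R) F (a * expR (- a * t) * (1 + cos (b * t))).
    have d1 := is_deriveB (is_deriveZ b (is_derive_sinM b t)) (is_deriveZ a (is_derive_cosM b t)).
    have d2 := is_deriveB (is_deriveZ (a ^+ 2 + b ^+ 2)^-1 (is_deriveZ a d1))
      (is_derive_cst (1 : R) t 1).
    have d3 := is_deriveM (is_derive_expM (- a) t) d2.
    by apply: is_derive_eq d3 _; rewrite !fctE /= /GRing.scale /=; field.
  have cF := is_derive_continuous dF.
  rewrite (@Rintegral_ge0_continuous_FTC2y _ _ F 0 0).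
  - by rewrite /F !mulr0 expR0 sin0 cos0; field.
  - move=> t _; apply: mulr_ge0; first by rewrite mulr_ge0 ?expR_ge0// ltW.
    by have := cos_geN1 (b * t); lra.
  - apply: continuous_subspaceT => t; apply: cvgM.
      apply: cvgM; first exact: cvg_cst.
      exact: continuous_phase (@continuous_expR R) t.
    by apply: cvgD; [exact: cvg_cst|exact: continuous_phase (@continuous_cos R) t].
  (* M bounds the trigonometric factor of F; together with exp(-at) <= 1/(at) it gives the decay. *)
  - pose M := (a ^+ 2 + b ^+ 2)^-1 * (a * (`|b| + a)) + 1.
    have M0 : 0 < M.
      by rewrite ltr_wpDl// !mulr_ge0 ?invr_ge0 ?addr_ge0 ?sqr_ge0// ltW.
    apply/cvgrPdist_le => e e0; near=> t.
    have t0 : 0 < t by near: t; exact: nbhs_pinfty_gt.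
    rewrite sub0r normrN /F normrM ger0_norm ?expR_ge0// mulNr expRN.
    have at0 : 0 < a * t by rewrite mulr_gt0.
    apply: (@le_trans _ _ ((a * t)^-1 * M)).
      apply: ler_pM; rewrite ?invr_ge0 ?expR_ge0//.
        rewrite lef_pV2 ?posrE ?expR_gt0// (le_trans _ (expR_ge1Dx _))//.
        by rewrite lerDr.
      rewrite (le_trans (ler_normB _ _))// normr1 lerD2r normrM ger0_norm; last first.
        by rewrite invr_ge0 addr_ge0 ?sqr_ge0.
      rewrite ler_wpM2l ?invr_ge0 ?addr_ge0 ?sqr_ge0// normrM gtr0_norm//.
      apply: ler_wpM2l; first exact: ltW.
      rewrite (le_trans (ler_normB _ _))// !normrM (gtr0_norm a0) lerD//.
        by rewrite -[leRHS]mulr1 ler_wpM2l// sin_max.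
      by rewrite -[leRHS]mulr1; apply: ler_wpM2l; [exact: ltW|exact: cos_max].
    rewrite ler_pdivrMl// -ler_pdivrMr// -ler_pdivrMl//.
  - by move=> t _; case: (dF t).
  - by apply: cvg_at_right_filter; exact: cF.
  - by move=> t _; rewrite derive1E; case: (dF t) => _ ->.
rewrite RintegralD// I1 => /addrI; apply.
Unshelve. all: by end_near. Qed.

End Kernels.

(** * Arctangent limits and the Poisson kernel *)

Section AtanLimits.
Variable R : realType.

Lemma atan_cvg_pos (c : R) : 0 < c -> atan (c * n.+1%:R) @[n --> \oo] --> (pi / 2 : R).
Proof.
move=> c0; apply: (@cvg_comp _ _ _ (fun n => c * n.+1%:R) atan _ _ _ _ (@cvgy_atan R)).
apply/cvgryPge => A; near=> n.
rewrite -ler_pdivrMl//; apply: (@le_trans _ _ n%:R); last by rewrite ler_nat.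
near: n; exact: nbhs_infty_ger.
Unshelve. all: by end_near. Qed.

Lemma atan_cvg_neg (c : R) : c < 0 -> atan (c * n.+1%:R) @[n --> \oo] --> (- (pi / 2) : R).
Proof.
rewrite -oppr_gt0 => /atan_cvg_pos h.
rewrite (_ : (fun n => _) = (fun n => - atan (- c * n.+1%:R))); first exact: cvgN h.
by apply/funext => n; rewrite mulNr atanN opprK.
Qed.

Lemma atan_diff_le1 (u v : R) : `|pi^-1 * (atan u - atan v)| <= 1.
Proof.
have pp := pi_gt0 R.
rewrite normrM gtr0_norm ?invr_gt0// ler_pdivrMl// mulr1.
have := atan_gtNpi2 u; have := atan_gtNpi2 v; have := atan_ltpi2 u; have := atan_ltpi2 v.
move: (atan u) (atan v) (pi : R) => A B P h1 h2 h3 h4.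
by rewrite ler_norml; apply/andP; split; lra.
Qed.

(** Each arctangent tends to plus or minus pi/2 according to the side of y on which its endpoint
    lies. The endpoints are excluded because the limit there is 1/2. *)
Lemma atan_diff_cvg (c p q y : R) : 0 < c -> p < q -> y != p -> y != q ->
  pi^-1 * (atan (c * (q - y) * n.+1%:R) - atan (c * (p - y) * n.+1%:R)) @[n --> \oo] -->
    (\1_`[p, q] y : R).
Proof.
move=> c0 pq yp yq; have pn0 : (pi : R) != 0 by rewrite gt_eqF// pi_gt0.
have pi2 (P : R) : P != 0 -> P^-1 * (P / 2 - - (P / 2)) = 1 by move=> P0; field.
have [qy|qy|qy] := ltgtP y q; last by rewrite qy eqxx in yq.
- have cq : 0 < c * (q - y) by rewrite mulr_gt0// subr_gt0.
  have [py|py|py] := ltgtP y p; last by rewrite py eqxx in yp.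
  + have cp : 0 < c * (p - y) by rewrite mulr_gt0// subr_gt0.
    rewrite indicE memNset; last by rewrite /= in_itv /= leNgt py.
    rewrite (_ : _ %:R = pi^-1 * (pi / 2 - pi / 2)); last by rewrite subrr mulr0.
    by apply: cvgM; [exact: cvg_cst|apply: cvgB; exact: atan_cvg_pos].
  + have cp : c * (p - y) < 0 by rewrite pmulr_rlt0// subr_lt0.
    rewrite indicE mem_set; last by rewrite /= in_itv /= !ltW.
    rewrite [_%:R](_ : _ = pi^-1 * (pi / 2 - - (pi / 2))); last by rewrite pi2.
    apply: cvgM; [exact: cvg_cst|apply: cvgB; [exact: atan_cvg_pos|exact: atan_cvg_neg]].
- have cq : c * (q - y) < 0 by rewrite pmulr_rlt0// subr_lt0.
  have cp : c * (p - y) < 0 by rewrite pmulr_rlt0// subr_lt0 (lt_trans pq).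
  rewrite indicE memNset; last by rewrite /= in_itv /= (leNgt y) qy andbF.
  rewrite (_ : _ %:R = pi^-1 * (- (pi / 2) - - (pi / 2))); last by rewrite subrr mulr0.
  by apply: cvgM; [exact: cvg_cst|apply: cvgB; exact: atan_cvg_neg].
Qed.

End AtanLimits.

Section PoissonKernel.
Variable R : realType.
Local Notation mu := (@lebesgue_measure R).
Implicit Types a p q x y : R.

(** For a > 0, the Fourier transform of exp(-a|t|), a kernel of total mass 1. It is written as a
    cosine transform so that it can be compared with the trapezoid on the frequency side. *)
Definition poisson a x := 2 / a * cos_transform (exponential_pdf a) x.

Lemma continuous_poisson a : 0 < a -> continuous (poisson a).
Proof.
move=> a0 x; apply: cvgM; first exact: cvg_cst.
exact: (continuous_cos_transform (integrable_exponential_pdf a0)).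
Qed.

Lemma poissonE a x : 0 < a -> poisson a x = 2 * a / (a ^+ 2 + (2 * pi * x) ^+ 2).
Proof.
move=> a0; rewrite /poisson cos_transform_exponential//; set b := 2 * pi * x.
have D0 : a ^+ 2 + b ^+ 2 != 0 by rewrite gt_eqF// ltr_pwDl ?exprn_gt0// sqr_ge0.
by field; rewrite D0 gt_eqF.
Qed.

Lemma poisson_le a x : 0 < a -> `|poisson a x| <= 2 / a.
Proof.
move=> a0; rewrite poissonE//; set b := 2 * pi * x.
have D0 : 0 < a ^+ 2 + b ^+ 2 by rewrite ltr_pwDl ?exprn_gt0// sqr_ge0.
rewrite ger0_norm ?divr_ge0 ?mulr_ge0 ?(ltW a0) ?(ltW D0)// ler_pdivrMr//.
rewrite mulrAC ler_pdivlMr// -mulrA ler_wpM2l// -expr2 lerDl sqr_ge0.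
by [].
Qed.

(** For a > 0 and p < q, the mass on [p, q] of the Poisson kernel centred at y: a smoothed indicator
    of [p, q]. *)
Definition atan_diff a p q y : R :=
  pi^-1 * (atan (2 * pi / a * (q - y)) - atan (2 * pi / a * (p - y))).

Lemma Rintegral_poisson a p q y : 0 < a -> p < q ->
  \int[mu]_(x in `[p, q]) poisson a (x - y) = atan_diff a p q y.
Proof.
move=> a0 pq; rewrite /atan_diff mulrBr.
have dF (x : R) : is_derive x (1 : R)
    (fun x => pi^-1 * atan (2 * pi / a * (x - y))) (poisson a (x - y)).
  have d1 := is_deriveZ (2 * pi / a) (is_deriveB (is_derive_id x (1 : R)) (is_derive_cst y x 1)).
  have d2 := @is_derive1_comp _ atan (fun x => 2 * pi / a * (x - y)) x _ _ (is_derive1_atan _) d1.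
  apply: is_derive_eq (is_deriveZ pi^-1 d2) _.
  rewrite poissonE// /GRing.scale /= subr0 mulr1; set z := x - y.
  have simplE (P : R) : P != 0 -> P^-1 * ((1 + (2 * P / a * z) ^+ 2)^-1 * (2 * P / a)) =
      2 * a / (a ^+ 2 + (2 * P * z) ^+ 2).
    move=> P0.
    have D0 : 0 < a ^+ 2 + (2 * P * z) ^+ 2 by rewrite ltr_pwDl ?exprn_gt0// sqr_ge0.
    have -> : 1 + (2 * P / a * z) ^+ 2 = (a ^+ 2 + (2 * P * z) ^+ 2) / a ^+ 2.
      by field; rewrite gt_eqF.
    by field; rewrite P0 !gt_eqF.
  by apply: simplE; rewrite gt_eqF// pi_gt0.
have cf : continuous (fun x => poisson a (x - y)).
  move=> x; apply: (@continuous_comp _ _ _ (fun x => x - y) (poisson a)).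
    by apply: cvgB; [exact: cvg_id|exact: cvg_cst].
  exact: continuous_poisson.
by rewrite (Rintegral_FTC2 pq cf dF).
Qed.

Lemma atan_diff_le a p q y : `|atan_diff a p q y| <= 1.
Proof. exact: atan_diff_le1. Qed.

(** [harmonic n] is 1/(n+1), so this is the limit a -> 0 taken along a sequence, as dominated
    convergence needs. *)
Lemma atan_diff_harmonic_cvg p q y : p < q -> y != p -> y != q ->
  atan_diff (harmonic n) p q y @[n --> \oo] --> (\1_`[p, q] y : R).
Proof.
move=> pq yp yq; have c0 : 0 < 2 * (pi : R) by rewrite mulr_gt0// pi_gt0.
have := atan_diff_cvg c0 pq yp yq.
have E (c u : R) n : c / n.+1%:R^-1 * u = c * u * n.+1%:R by rewrite invrK mulrAC.
rewrite (_ : (fun n => _) = (fun n => atan_diff (harmonic n) p q y))//.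
by apply/funext => n; rewrite /atan_diff /harmonic !E.
Qed.

Lemma continuous_atan_diff a p q : continuous (atan_diff a p q).
Proof.
move=> y; apply: cvgM; first exact: cvg_cst.
have h c z : {for y, continuous (fun y : R => atan (c * (z - y)))}.
  apply: (@continuous_comp _ _ _ (fun y : R => c * (z - y)) (@atan R)); last exact: continuous_atan.
  by apply: cvgM; [exact: cvg_cst|apply: cvgB; [exact: cvg_cst|exact: cvg_id]].
by apply: cvgB; exact: h.
Qed.

End PoissonKernel.

(** * The reproducing identity *)

Section Trapezoid.
Variable R : realType.
Local Notation mu := (@lebesgue_measure R).
Variables (tau delta : R).
Hypotheses (tau0 : 0 < tau) (delta0 : 0 < delta).

(* Twice the restriction to the nonnegative half-line of the even trapezoid that is 1 on
   [[-tau, tau]] and vanishes outside [[-tau - 1/delta, tau + 1/delta]]. *)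
Definition trapezoid (t : R) : R :=
  2 * delta * (triangle (tau + delta^-1) t - triangle tau t).

Lemma triangle_in (S t : R) : 0 <= t <= S -> triangle S t = S - t.
Proof. by move=> tS; rewrite /triangle patchE mem_set//= in_itv. Qed.

Lemma triangle_out (S t : R) : ~~ (0 <= t <= S) -> triangle S t = 0.
Proof. by move=> tS; rewrite /triangle patchE memNset//= in_itv; exact/negP. Qed.

Let dV0 : 0 < delta^-1. Proof. by rewrite invr_gt0. Qed.

Lemma trapezoid_in t : 0 <= t <= tau -> trapezoid t = 2.
Proof.
move=> tt; rewrite /trapezoid !triangle_in//.
  by rewrite opprB addrA subrK addrAC subrr add0r mulfK// gt_eqF.
by case/andP: tt => -> /= t1; rewrite (le_trans t1)// lerDl ltW.
Qed.

Lemma trapezoid_lt0 t : t < 0 -> trapezoid t = 0.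
Proof. by move=> t0; rewrite /trapezoid !triangle_out ?subrr ?mulr0// leNgt t0. Qed.

Lemma trapezoid_ge0 t : 0 <= trapezoid t.
Proof.
have [t0|t0] := ltP t 0; first by rewrite trapezoid_lt0.
have [tt|tt] := leP t tau; first by rewrite trapezoid_in ?t0.
rewrite /trapezoid (@triangle_out tau); last by rewrite negb_and -!ltNge tt orbT.
rewrite subr0; apply: mulr_ge0; first by rewrite mulr_ge0// ltW.
case: (boolP (0 <= t <= tau + delta^-1)) => [h|/triangle_out ->//].
by rewrite triangle_in// subr_ge0; case/andP: h.
Qed.

Lemma integrable_trapezoid : mu.-integrable setT (EFin \o trapezoid).
Proof.
have := integrableZl measurableT (2 * delta)
  (integrableB measurableT (integrable_triangle (tau + delta^-1)) (integrable_triangle tau)).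
by apply: eq_integrable.
Qed.

Lemma cos_transform_trapezoidE x : cos_transform trapezoid x =
  2 * delta * (cos_transform (triangle (tau + delta^-1)) x - cos_transform (triangle tau) x).
Proof.
have ic S : mu.-integrable setT (EFin \o (fun t => triangle S t * cos (2 * pi * x * t))).
  apply: (@integrable_mul_bounded _ _ _ 1 (integrable_triangle S)) => [|t]; last exact: cos_max.
  by apply: continuous_measurable_fun; exact: continuous_phase (@continuous_cos R).
rewrite /cos_transform -RintegralB// -RintegralZl//.
  by apply: eq_Rintegral => t _; rewrite /trapezoid; ring.
exact: (integrableB measurableT (ic _) (ic _)).
Qed.

Lemma cos_transform_trapezoid0 : cos_transform trapezoid 0 = 2 * tau + delta^-1.
Proof.
rewrite cos_transform_trapezoidE !cos_transform_triangle0 ?addr_gt0//.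
by field; rewrite gt_eqF.
Qed.

(** The trapezoid is nonnegative, so its transform is largest at 0, where it equals the integral. *)
Lemma cos_transform_trapezoid_le x : `|cos_transform trapezoid x| <= 2 * tau + delta^-1.
Proof.
rewrite (le_trans (cos_transform_bound _ integrable_trapezoid))//.
rewrite -cos_transform_trapezoid0 le_eqVlt; apply/orP; left; apply/eqP.
by apply: eq_Rintegral => t _; rewrite mulr0 mul0r cos0 mulr1 ger0_norm// trapezoid_ge0.
Qed.

(** In the difference of the two Fejer terms the constants 1 cancel. What remains is a difference of
    cosines, at most 2, over 2 pi^2 x^2, and pi >= 2 gives the factor 4. *)
Lemma cos_transform_trapezoid_decay x : x != 0 ->
  `|cos_transform trapezoid x| <= delta / (4 * x ^+ 2).
Proof.
move=> x0; rewrite cos_transform_trapezoidE !cos_transform_triangle ?addr_gt0//.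
set c1 := cos _; set c2 := cos _.
have p2 : 4 <= (pi : R) ^+ 2.
  by rewrite (_ : 4 = 2 ^+ 2) ?lerXn2r ?nnegrE ?pi_ge0 ?pi_ge2//; ring.
have x2 : 0 < x ^+ 2 by rewrite exprn_even_gt0.
have pin0 : (pi : R) != 0 by rewrite gt_eqF// pi_gt0.
have simplE (p y : R) : p != 0 -> y != 0 ->
    2 * delta * ((1 - c1) / (2 * p * y) ^+ 2 - (1 - c2) / (2 * p * y) ^+ 2) =
    delta / y ^+ 2 * ((c2 - c1) / (2 * p ^+ 2)).
  by move=> p0 y0; field; rewrite p0.
rewrite simplE//.
rewrite normrM ger0_norm; last by rewrite divr_ge0// ltW.
rewrite (_ : delta / (4 * _) = delta / x ^+ 2 * 4^-1); last by field.
apply: ler_wpM2l; first by rewrite divr_ge0// ltW.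
have pp : 0 < 2 * (pi : R) ^+ 2 by lra.
rewrite normrM normfV (gtr0_norm pp) ler_pdivrMr//.
have : `|c2 - c1| <= 2.
  by rewrite (le_trans (ler_normB _ _))// (_ : 2 = 1 + 1) ?lerD ?cos_max//; ring.
lra.
Qed.

End Trapezoid.

(** * Convolution with the trapezoid kernel reproduces a band-limited function *)

Section Reproducing.
Variable R : realType.
Local Notation mu := (@lebesgue_measure R).
Variables (tau delta : R) (g : R -> R).
Hypotheses (tau0 : 0 < tau) (delta0 : 0 < delta).
Hypothesis ig : mu.-integrable setT (EFin \o g).
Hypothesis g_cos : forall t, tau < `|t| -> cos_transform g t = 0.
Hypothesis g_sin : forall t, tau < `|t| -> sin_transform g t = 0.

Let N := \int[mu]_x `|g x|.
Let N0 : 0 <= N. Proof. by apply: Rintegral_ge0. Qed.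

Let icos t : mu.-integrable setT (EFin \o (fun y => g y * cos (2 * pi * t * y))).
Proof.
apply: (@integrable_mul_bounded _ _ _ 1 ig) => [|y]; last exact: cos_max.
by apply: continuous_measurable_fun; exact: continuous_phase (@continuous_cos R).
Qed.

Let isin t : mu.-integrable setT (EFin \o (fun y => g y * sin (2 * pi * t * y))).
Proof.
apply: (@integrable_mul_bounded _ _ _ 1 ig) => [|y]; last exact: sin_max.
by apply: continuous_measurable_fun; exact: continuous_phase (@continuous_sin R).
Qed.

(** The real part of the Fourier transform of g at t times exp(2 pi i x t), which also equals the
    integral of g(y) cos(2 pi t (x - y)) in y. *)
Let D x t := cos (2 * pi * x * t) * cos_transform g t + sin (2 * pi * x * t) * sin_transform g t.

Let D_bound x t : `|D x t| <= 2 * N.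
Proof.
rewrite (le_trans (ler_normD _ _))// (_ : 2 * N = 1 * N + 1 * N); last by ring.
by rewrite !normrM lerD// ler_pM// ?cos_max ?sin_max ?cos_transform_bound ?sin_transform_bound.
Qed.

(** Convolving with the cosine transform of w amounts to weighting the frequencies of g by w:
    Fubini, then the addition formula for cos(2 pi (x - y) t). *)
Let convE w x : mu.-integrable setT (EFin \o w) ->
  \int[mu]_y (g y * cos_transform w (x - y)) = \int[mu]_t (w t * D x t).
Proof.
move=> iw; rewrite /cos_transform.
have mk : measurable_fun setT (fun z : R * R => cos (2 * pi * (x - z.1) * z.2)).
  apply: (measurableT_comp (continuous_measurable_fun (@continuous_cos R))).
  apply: measurable_funM => //; apply: measurable_funM => //; exact: measurable_funB.
have := Rintegral_swap ig iw mk (fun z => cos_max _) => /= ->.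
apply: eq_Rintegral => t _; congr (_ * _).
rewrite /D /cos_transform /sin_transform -!RintegralZl// -RintegralD//; last 2 first.
- exact: (integrableZl measurableT (cos (2 * pi * x * t)) (icos t)).
- exact: (integrableZl measurableT (sin (2 * pi * x * t)) (isin t)).
apply: eq_Rintegral => y _.
rewrite (_ : 2 * pi * (x - y) * t = 2 * pi * x * t - 2 * pi * t * y); last by ring.
by rewrite cosB; ring.
Qed.

Let measurable_D x : measurable_fun setT (D x).
Proof.
apply: continuous_measurable_fun => t; apply: cvgD; apply: cvgM.
- exact: continuous_phase (@continuous_cos R) t.
- exact: continuous_cos_transform.
- exact: continuous_phase (@continuous_sin R) t.
- exact: continuous_sin_transform.
Qed.

Let V := cos_transform (trapezoid tau delta).

(** The two weights are 2 exp(-at) and 2 on [0, tau], differing by at most 2 a tau. Both vanish for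
    t < 0, and [D x] vanishes for t > tau. With |D| <= 2N and an interval of length tau this gives 4
    a tau^2 N. *)
Let poisson_near a x : 0 < a ->
  `|\int[mu]_y (g y * poisson a (x - y)) - \int[mu]_y (g y * V (x - y))| <= a * (4 * tau ^+ 2 * N).
Proof.
move=> a0.
have iwa : mu.-integrable setT (EFin \o (fun t => 2 / a * exponential_pdf a t)).
  exact: (integrableZl measurableT (2 / a) (integrable_exponential_pdf a0)).
have poissonE y : poisson a y = cos_transform (fun t => 2 / a * exponential_pdf a t) y.
  rewrite /poisson /cos_transform -RintegralZl//.
    by apply: eq_Rintegral => t _; rewrite mulrA.
  apply: (@integrable_mul_bounded _ _ _ 1 (integrable_exponential_pdf a0)) => [|t].
    by apply: continuous_measurable_fun; exact: continuous_phase (@continuous_cos R).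
  exact: cos_max.
under eq_Rintegral do rewrite poissonE.
rewrite !convE//; last exact: integrable_trapezoid.
have iD w : mu.-integrable setT (EFin \o w) -> mu.-integrable setT (EFin \o (fun t => w t * D x t)).
  by move=> iw; exact: integrable_mul_bounded iw (measurable_D x) (D_bound x).
rewrite -RintegralB//; [|exact: iD|exact/iD/integrable_trapezoid].
have iB : mu.-integrable setT (EFin \o (fun t =>
    2 / a * exponential_pdf a t * D x t - trapezoid tau delta t * D x t)).
  by have := integrableB measurableT (iD _ iwa) (iD _ (integrable_trapezoid tau delta)).
rewrite (le_trans (le_normr_Rintegral _ iB))//.
have ii : mu.-integrable setT (EFin \o (fun t => 4 * a * tau * N * \1_`[0, tau] t)).
  exact: (integrableZl measurableT (4 * a * tau * N) (integrable_indic_itv 0 tau true false)).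
have c0 : 0 <= 4 * a * tau * N by apply: mulr_ge0 => //; rewrite !mulr_ge0// ltW.
apply: (@le_trans _ _ (\int[mu]_t (4 * a * tau * N * \1_`[0, tau] t))).
  apply: le_Rintegral => //; first exact: integrable_norm.
  move=> t _; rewrite -mulrBl normrM.
  have [t0|t0] := ltP t 0.
    rewrite lt0_exponential_pdf// trapezoid_lt0// mulr0 subrr normr0 mul0r.
    by rewrite mulr_ge0.
  have [tt|tt] := leP t tau; last first.
    rewrite /D g_cos ?g_sin ?(lt_le_trans tt (ler_norm _))// !mulr0 addr0 normr0 mulr0.
    by rewrite mulr_ge0.
  rewrite indicE mem_set /= ?in_itv /= ?t0// mulr1 trapezoid_in ?t0// exponential_pdfE//.
  rewrite (_ : _ - 2 = 2 * (expR (- a * t) - 1)); last by field; rewrite gt_eqF.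
  rewrite (_ : 4 * a * tau * N = (2 * (a * tau)) * (2 * N)); last by ring.
  apply: ler_pM; rewrite ?D_bound//; rewrite normrM ger0_norm// ler_wpM2l//.
  have e1 : expR (- a * t) <= 1.
    by rewrite -expR0 ler_expR mulNr oppr_le0 mulr_ge0// ltW.
  rewrite ler0_norm ?subr_le0// opprB.
  have := expR_ge1Dx (- a * t); have : a * t <= a * tau by rewrite ler_wpM2l// ltW.
  lra.
rewrite RintegralZl//; last exact: integrable_indic_itv.
have -> : \int[mu]_t \1_`[0, tau] t = tau.
  have muI : mu `[0, tau]%classic = tau%:E.
    by rewrite lebesgue_measure_itv /= lte_fin tau0 -EFinD subr0.
  by rewrite /Rintegral integral_indic// setIT [X in fine X]muI.
by rewrite le_eqVlt; apply/orP; left; apply/eqP; ring.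
Qed.

(** Fubini moves the integral over the segment onto the kernel, where it has a closed form. *)
Let convolve_poisson_integral a p q : 0 < a -> p < q ->
  \int[mu]_(x in `[p, q]) (\int[mu]_y (g y * poisson a (x - y))) =
  \int[mu]_y (g y * atan_diff a p q y).
Proof.
move=> a0 pq.
have mk : measurable_fun setT (fun z : R * R => poisson a (z.2 - z.1)).
  apply: (measurableT_comp (continuous_measurable_fun (continuous_poisson a0))).
  exact: measurable_funB.
have := Rintegral_swap ig (integrable_indic_itv p q true false) mk (fun z => poisson_le _ a0).
move=> /= swapE; rewrite Rintegral_indicM -[LHS]swapE.
apply: eq_Rintegral => y _; congr (_ * _).
by rewrite -Rintegral_indicM; exact: Rintegral_poisson.
Qed.

Let atan_diff_limit p q : p < q ->
  \int[mu]_y (g y * atan_diff (harmonic n) p q y) @[n --> \oo] --> \int[mu]_(y in `[p, q]) g y.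
Proof.
move=> pq.
have mad n : measurable_fun setT (fun y => g y * atan_diff (harmonic n) p q y).
  apply: measurable_funM; first exact: measurable_real_fun ig.
  by apply: continuous_measurable_fun; exact: continuous_atan_diff.
have mind : measurable_fun setT (fun y => g y * \1_`[p, q] y).
  by apply: measurable_funM; [exact: measurable_real_fun ig|exact: measurable_indic].
have lim_ae : {ae mu, forall y, setT y ->
    (g y * atan_diff (harmonic n) p q y)%:E @[n --> \oo] --> (g y * \1_`[p, q] y)%:E}.
  (* Pointwise convergence can fail only at the two endpoints, a null set. *)
  exists ([set p] `|` [set q]); split; first by apply: measurableU; exact: measurable_set1.
    have c2 : countable ([set p] `|` [set q])
      by apply: finite_set_countable; rewrite finite_setU; split; exact: finite_set1.
    exact: countable_lebesgue_measure0.
  move=> y /=; apply: contra_notP => /not_orP[/eqP yp /eqP yq] _.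
  apply: cvg_EFin; first by near=> n.
  by apply: cvgM; [exact: cvg_cst|exact: atan_diff_harmonic_cvg].
have dom_ae : {ae mu, forall y n, setT y ->
    (`|(g y * atan_diff (harmonic n) p q y)%:E| <= `|g y|%:E)%E}.
  apply: aeW => y n _; rewrite /= lee_fin normrM -[leRHS]mulr1 ler_wpM2l//.
  exact: atan_diff_le.
have mfn n : measurable_fun setT (fun y => (g y * atan_diff (harmonic n) p q y)%:E).
  by apply/measurable_EFinP.
have mf : measurable_fun setT (fun y => (g y * \1_`[p, q] y)%:E).
  by apply/measurable_EFinP.
have [iind _ lim] :=
  @dominated_convergence _ _ _ mu setT measurableT _ _ _ mfn mf lim_ae (integrable_norm ig) dom_ae.
have -> : \int[mu]_(y in `[p, q]) g y = \int[mu]_y (g y * \1_`[p, q] y).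
  by rewrite Rintegral_indicM; apply: eq_Rintegral => y _; rewrite mulrC.
apply: fine_cvg; rewrite fineK; last exact: integrable_fin_num iind.
exact: lim.
Unshelve. all: by end_near. Qed.

Definition convolution (K : R -> R) x := \int[mu]_y (g y * K (x - y)).

Lemma continuous_convolution K M : continuous K -> (forall x, `|K x| <= M) ->
  continuous (convolution K).
Proof.
move=> cK KM; apply: (@continuous_integral_param _ g (fun x y => K (x - y)) M) => //.
- move=> y x; apply: (@continuous_comp _ _ _ (fun x => x - y) K); last exact: cK.
  by apply: cvgB; [exact: cvg_id|exact: cvg_cst].
- move=> x; apply: continuous_measurable_fun => y.
  apply: (@continuous_comp _ _ _ (fun y => x - y) K); last exact: cK.
  by apply: cvgB; [exact: cvg_cst|exact: cvg_id].
Qed.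

Let cV : continuous (convolution V).
Proof.
apply: (@continuous_convolution _ (2 * tau + delta^-1)).
  exact: continuous_cos_transform (integrable_trapezoid tau delta).
exact: cos_transform_trapezoid_le.
Qed.

Let integrable_segment f p q : continuous f -> mu.-integrable `[p, q] (EFin \o f).
Proof.
move=> cf.
by apply: continuous_compact_integrable (@segment_compact _ p q) (continuous_subspaceT cf).
Qed.

(** The Poisson convolutions integrated over [p, q] tend to both sides: to the right one by
    dominated convergence, to the left one by [poisson_near], which is uniform in x. *)
Let reproducing_segment p q : p < q ->
  \int[mu]_(x in `[p, q]) convolution V x = \int[mu]_(x in `[p, q]) g x.
Proof.
move=> pq.
pose u n := \int[mu]_(x in `[p, q]) convolution (poisson (harmonic n)) x.
have h0 n : 0 < harmonic n :> R by rewrite invr_gt0.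
have ulim : u n @[n --> \oo] --> \int[mu]_(x in `[p, q]) g x.
  rewrite (_ : u = (fun n => \int[mu]_y (g y * atan_diff (harmonic n) p q y))); last first.
    by apply/funext => n; exact: convolve_poisson_integral.
  exact: atan_diff_limit.
have ulimV : u n @[n --> \oo] --> \int[mu]_(x in `[p, q]) convolution V x.
  pose B := 4 * tau ^+ 2 * N * (q - p).
  have uB n : `|\int[mu]_(x in `[p, q]) convolution V x - u n| <= harmonic n * B.
    have ip : mu.-integrable `[p, q] (EFin \o convolution (poisson (harmonic n))).
      apply: integrable_segment; apply: continuous_convolution (continuous_poisson (h0 n)) _.
      by move=> x; exact: poisson_le.
    have iV := integrable_segment p q cV.
    rewrite distrC /u -RintegralB//.
    have iB : mu.-integrable `[p, q] (EFin \o
        (fun x => convolution (poisson (harmonic n)) x - convolution V x)).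
      have := integrableB _ ip iV; apply; exact: measurable_itv.
    rewrite (le_trans (le_normr_Rintegral _ iB))//.
    apply: (@le_trans _ _ (\int[mu]_(x in `[p, q]) (harmonic n * (4 * tau ^+ 2 * N)))).
      apply: le_Rintegral => //; first exact: integrable_norm.
        by apply: integrable_segment => x; exact: cvg_cst.
      by move=> x _; exact: poisson_near.
    have muI : mu `[p, q]%classic = (q - p)%:E.
      by rewrite lebesgue_measure_itv /= lte_fin pq.
    by rewrite Rintegral_cst// [X in fine X]muI /B /= [leRHS]mulrA.
  have hB : harmonic n * B @[n --> \oo] --> (0 : R).
    by rewrite -(mul0r B); apply: cvgM; [exact: cvg_harmonic|exact: cvg_cst].
  apply/cvgrPdist_le => e e0; near=> n; apply: (le_trans (uB n)).
  have : `|harmonic n * B - 0| <= e by near: n; exact: cvgr_distC_le.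
  by rewrite subr0; apply: le_trans; exact: ler_norm.
by rewrite -(cvg_lim (@Rhausdorff R) ulim) (cvg_lim (@Rhausdorff R) ulimV).
Unshelve. all: by end_near. Qed.

(** At a Lebesgue point x of g, g(x) is the derivative at x of the primitive of g from x - 1. The
    continuous convolution is likewise the derivative of its own primitive. *)
Lemma reproducing : {ae mu, forall x, g x = convolution V x}.
Proof.
have : locally_integrable setT g by apply: open_integrable_locally => //; exact: openT.
move=> /lebesgue_differentiation.
apply: filterS; first exact: (ae_filter_ringOfSetsType mu).
move=> x gx.
have x1 : x - 1 < x by rewrite ltrBlDr ltrDl.
have x2 : x < x + 1 by rewrite ltrDl.
have ig' : mu.-integrable [set` Interval (BLeft (x - 1)) (BRight (x + 1))] (EFin \o g).
  by apply: integrableS ig => //; exact: measurable_itv.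
have [d1 d2] := FTC1_lebesgue_pt x2 ig' x1 gx.
have [d3 d4] := continuous_FTC1_closed x2 (integrable_segment (x - 1) (x + 1) cV) x1 (@cV x).
rewrite -[LHS]d2 -[RHS]d4 !derive1E; apply: near_eq_derive; rewrite ?oner_neq0//.
(* The two primitives agree for every y > x - 1, hence near x. *)
near=> y; rewrite [RHS]reproducing_segment//; near: y; exact: lt_nbhsr.
Unshelve. all: by end_near. Qed.

End Reproducing.

(** * Concentration *)

Section WindowSum.
Variable R : realType.
Local Notation mu := (@lebesgue_measure R).

(** The induction carries the remainder 1/(4(k+1)), which telescopes because (2k+3)^2 >=
    4(k+1)(k+2); the case k = 0 is an equality. *)
Lemma sum_inv_odd_sqr n : \sum_(0 <= j < n) ((2 * j%:R + 1) ^+ 2)^-1 <= 5 / 4 :> R.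
Proof.
suff H k : \sum_(0 <= j < k.+1) ((2 * j%:R + 1) ^+ 2)^-1 <= 5 / 4 - (4 * (k%:R + 1))^-1 :> R.
  case: n => [|n]; first by rewrite big_nil divr_ge0.
  by rewrite (le_trans (H n))// lerBlDr lerDl invr_ge0 mulr_ge0// addr_ge0.
elim: k => [|k IH]; first by rewrite big_nat1 mulr0 add0r expr1n invr1 mulr1; lra.
rewrite big_nat_recr//= (le_trans (lerD IH (lexx _)))//.
have : 0 <= k%:R :> R by [].
rewrite -[k.+1%:R]natr1; move: (k%:R : R) => u u0.
have -> : 5 / 4 - (4 * (u + 1 + 1))^-1 =
    5 / 4 - (4 * (u + 1))^-1 + (4 * (u + 1) * (u + 1 + 1))^-1.
  by field; apply/andP; split; rewrite gt_eqF//; lra.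
rewrite lerD2l lef_pV2 ?posrE ?exprn_gt0 ?mulr_gt0//; lra.
Qed.

Variables (K : R -> R) (c0 delta : R).
Hypotheses (delta0 : 0 < delta) (c00 : 0 <= c0) (cK : continuous K).
Hypotheses (Kc0 : forall z, `|K z| <= c0).
Hypotheses (Kdecay : forall z, z != 0 -> `|K z| <= delta / (4 * z ^+ 2)).

Let I (a : R) := `[a, a + delta]%classic.
(** The decay bound delta / (4 z^2) evaluated at |z| = (j + 1/2) delta. *)
Let m (j : nat) : R := (delta * (2 * j%:R + 1) ^+ 2)^-1.

Let m_ge0 j : 0 <= m j.
Proof. by rewrite invr_ge0 mulr_ge0 ?sqr_ge0// ltW. Qed.

Let I_ge0 (A : set R) x : 0 <= \1_A x :> R.
Proof. by rewrite indicE. Qed.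

Let K_far j z : (j%:R + 1 / 2) * delta <= `|z| -> `|K z| <= m j.
Proof.
move=> zj; have j0 : 0 <= j%:R :> R by [].
have p0 : 0 < (j%:R + 1 / 2) * delta by rewrite mulr_gt0//; lra.
have z0 : 0 < `|z| by exact: lt_le_trans zj.
rewrite (le_trans (Kdecay _)) -?normr_gt0// -real_normK ?num_real//.
rewrite /m ler_pdivrMr ?mulr_gt0 ?exprn_gt0// ler_pdivlMl; last first.
  by rewrite mulr_gt0// exprn_gt0//; lra.
have : ((j%:R + 1 / 2) * delta) ^+ 2 <= `|z| ^+ 2 by rewrite lerXn2r// nnegrE ltW.
by move: (`|z| ^+ 2) => Z; rewrite !expr2; nra.
Qed.

Variables (N : set R) (y : R).
Hypothesis mN : measurable N.

(** The two windows of length delta, right and left of y, that cover the distances from (j + 1/2)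
    delta to (j + 3/2) delta. *)
Let term j x : R :=
  m j * (\1_(I (y + (j%:R + 1 / 2) * delta)) x + \1_(I (y - (j%:R + 3 / 2) * delta)) x).

Let term_ge0 j x : 0 <= term j x.
Proof. by rewrite mulr_ge0// addr_ge0. Qed.

(** The central window, of radius delta/2, uses the uniform bound c0; any other point lies in a
    window of some pair j and uses the decay. *)
Let K_dom x : (`|K (x - y)|%:E <=
  (c0 * \1_(I (y - delta / 2)) x)%:E + \sum_(j <oo) (term j x)%:E)%E.
Proof.
have S0 : (0 <= \sum_(j <oo) (term j x)%:E)%E by apply: nneseries_ge0 => j _ _; rewrite lee_fin.
have [xy|xy] := leP `|x - y| (delta / 2).
  apply: (@le_trans _ _ (c0 * \1_(I (y - delta / 2)) x)%:E); last by rewrite leeDl.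
  rewrite indicE mem_set ?mulr1 ?lee_fin// /I /= in_itv /=.
  by move: xy; rewrite ler_norml => /andP[h1 h2]; apply/andP; split; lra.
apply: (@le_trans _ _ (\sum_(j <oo) (term j x)%:E)%E); last first.
  by rewrite leeDr// lee_fin mulr_ge0.
(* u is the distance from x to the central window in units of delta; its integer part is the index
   of the pair. *)
pose u := (`|x - y| - delta / 2) / delta.
have u0 : 0 <= u by rewrite divr_ge0 ?ltW// subr_gt0.
pose j := Num.truncn u.
have /andP[j1 j2] : j%:R <= u < j.+1%:R by exact: truncn_itv.
have uE : `|x - y| = (u + 1 / 2) * delta by rewrite /u; field; rewrite gt_eqF.
apply: (@le_trans _ _ (term j x)%:E); last first.
  apply: (@le_trans _ _ (\sum_(0 <= i < j.+1) (term i x)%:E)%E); last first.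
    by apply: nneseries_lim_ge => i _ _; rewrite lee_fin.
  rewrite big_nat_recr//= leeDr//; apply: sume_ge0 => i _; by rewrite lee_fin.
rewrite lee_fin /term -[leLHS]mulr1; apply: ler_pM => //.
  by apply: K_far; rewrite uE ler_wpM2r ?(ltW delta0)// lerD2r.
have lo : (j%:R + 1 / 2) * delta <= `|x - y|.
  by rewrite uE ler_wpM2r ?(ltW delta0)// lerD2r.
have hi : `|x - y| <= (j%:R + 3 / 2) * delta.
  by rewrite uE ler_wpM2r ?(ltW delta0)//; move: j2; rewrite -[j.+1%:R]natr1; lra.
have [xy0|xy0] := leP 0 (x - y).
  rewrite [X in _ <= X + _]indicE mem_set ?lerDl// /I /= in_itv /=.
  by move: lo hi; rewrite ger0_norm// => lo hi; apply/andP; split; lra.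
rewrite [X in _ <= _ + X]indicE mem_set ?lerDr// /I /= in_itv /=.
by move: lo hi; rewrite ltr0_norm// => lo hi; apply/andP; split; lra.
Qed.

Let W := window_density N delta.

Let I_le_W a : (mu (I a `&` N) <= W)%E.
Proof. by rewrite setIC; apply: ereal_sup_ubound; exists a. Qed.

Let W0 : (0 <= W)%E.
Proof. exact: le_trans (measure_ge0 _ _) (I_le_W 0). Qed.

Let mI a : measurable (I a). Proof. exact: measurable_itv. Qed.

Let int_I (c a : R) : 0 <= c -> (\int[mu]_(x in N) (c * \1_(I a) x)%:E <= c%:E * W)%E.
Proof.
move=> c_ge0; under eq_integral do rewrite EFinM.
rewrite ge0_integralZl//; last first.
  by apply/measurable_EFinP; apply: measurable_funTS; apply: measurable_indic; exact: mI.
rewrite integral_indic//; last exact: mI.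
by apply: lee_wpmul2l; [rewrite lee_fin|exact: I_le_W].
Qed.

Let measurable_cI (c a : R) : measurable_fun N (fun x => (c * \1_(I a) x)%:E).
Proof.
apply/measurable_EFinP; apply: measurable_funM; first exact: measurable_cst.
by apply: measurable_funTS; apply: measurable_indic; exact: mI.
Qed.

Let termE j x : (term j x)%:E = ((m j * \1_(I (y + (j%:R + 1 / 2) * delta)) x)%:E +
  (m j * \1_(I (y - (j%:R + 3 / 2) * delta)) x)%:E)%E.
Proof. by rewrite /term mulrDr EFinD. Qed.

Let measurable_term j : measurable_fun N (fun x => (term j x)%:E).
Proof. by under eq_fun do rewrite termE; exact: emeasurable_funD. Qed.

Let int_term j : (\int[mu]_(x in N) (term j x)%:E <= (2 * m j)%:E * W)%E.
Proof.
under eq_integral do rewrite termE.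
rewrite ge0_integralD; [|exact: mN|by move=> x _; rewrite lee_fin mulr_ge0|exact: measurable_cI
  |by move=> x _; rewrite lee_fin mulr_ge0|exact: measurable_cI].
rewrite (_ : 2 * m j = m j + m j); last by ring.
by rewrite EFinD ge0_muleDl ?lee_fin//; apply: leeD; exact: int_I.
Qed.

Let measurable_series : measurable_fun N (fun x => \sum_(j <oo) (term j x)%:E)%E.
Proof.
apply: (@ge0_emeasurable_sum _ _ _ N (fun j x => (term j x)%:E) xpredT).
  by move=> j x _ _; rewrite lee_fin.
by move=> j _; exact: measurable_term.
Qed.

(** Every window meets N in measure at most W. The central one costs c0 W and the pair j costs 2
    m(j) W, and the pairs sum to at most (2/delta)(5/4) W. *)
Lemma window_integral :
  (\int[mu]_(x in N) `|K (x - y)|%:E <= (c0 + 5 / 2 * delta^-1)%:E * W)%E.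
Proof.
apply: (@le_trans _ _ (\int[mu]_(x in N)
    ((c0 * \1_(I (y - delta / 2)) x)%:E + \sum_(j <oo) (term j x)%:E))%E).
  apply: ge0_le_integral => //.
  - apply/measurable_EFinP; apply: measurable_funTS; apply: continuous_measurable_fun => x.
    apply: cvg_norm; apply: (@continuous_comp _ _ _ (fun x => x - y) K); last exact: cK.
    by apply: cvgB; [exact: cvg_id|exact: cvg_cst].
  - by apply: emeasurable_funD; [exact: measurable_cI|exact: measurable_series].
rewrite ge0_integralD; [|exact: mN|by move=> x _; rewrite lee_fin mulr_ge0|exact: measurable_cI
  |by move=> x _; apply: nneseries_ge0 => j _ _; rewrite lee_fin|exact: measurable_series].
rewrite EFinD ge0_muleDl ?lee_fin//; last by rewrite mulr_ge0 ?invr_ge0 ?ltW.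
apply: leeD; first exact: int_I.
rewrite integral_nneseries//; last by move=> j x _; rewrite lee_fin.
apply: lime_le.
  by apply: is_cvg_nneseries => j _ _; apply: integral_ge0 => x _; rewrite lee_fin.
apply: nearW => n.
apply: (@le_trans _ _ (\sum_(0 <= j < n) ((2 * m j)%:E * W))%E).
  by apply: lee_sum => j _; exact: int_term.
rewrite -ge0_sume_distrl; last by move=> j _; rewrite lee_fin mulr_ge0.
apply: lee_wpmul2r => //; rewrite sumEFin lee_fin.
have -> : \sum_(0 <= j < n) (2 * m j) = 2 * delta^-1 * \sum_(0 <= j < n) ((2 * j%:R + 1) ^+ 2)^-1.
  by rewrite mulr_sumr; apply: eq_bigr => j _; rewrite /m invfM mulrA.
rewrite (_ : 5 / 2 * delta^-1 = 2 * delta^-1 * (5 / 4)); last by field; rewrite gt_eqF.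
by apply: ler_wpM2l; [rewrite mulr_ge0// invr_ge0 ltW|exact: sum_inv_odd_sqr].
Qed.

End WindowSum.

(** * The concentration inequality for complex-valued functions *)

Section Concentration.
Variable R : realType.
Local Notation mu := (@lebesgue_measure R).
Local Notation normc := (@ComplexField.Normc.normc R).

Lemma normcE (z : R[i]) : normc z = Num.sqrt (complex.Re z ^+ 2 + complex.Im z ^+ 2).
Proof. by case: z. Qed.

Lemma normc_ge0 (z : R[i]) : 0 <= normc z.
Proof. by rewrite normcE sqrtr_ge0. Qed.

Lemma normc_le (z : R[i]) : normc z <= `|complex.Re z| + `|complex.Im z|.
Proof.
rewrite normcE -[leRHS]ger0_norm ?addr_ge0// -sqrtr_sqr ler_wsqrtr// sqrrD.
rewrite !real_normK ?num_real// -addrA lerD2l.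
by rewrite lerDr mulrn_wge0// mulr_ge0.
Qed.

(** Cauchy-Schwarz in the plane, from Lagrange's identity: the defect is the square of u b - v a. *)
Lemma normc_dual (u v : R) (z : R[i]) : u ^+ 2 + v ^+ 2 = 1 ->
  `|u * complex.Re z + v * complex.Im z| <= normc z.
Proof.
move=> uv; rewrite normcE -sqrtr_sqr ler_wsqrtr//.
move: (complex.Re z) (complex.Im z) => a b.
rewrite -[leRHS]mul1r -uv -subr_ge0.
by rewrite (_ : _ - _ = (u * b - v * a) ^+ 2) ?sqr_ge0//; ring.
Qed.

Lemma measurable_normc (G : R -> R[i]) :
  measurable_fun setT (fun x => complex.Re (G x)) ->
  measurable_fun setT (fun x => complex.Im (G x)) ->
  measurable_fun setT (fun x => normc (G x)).
Proof.
move=> mr mi; under eq_fun do rewrite normcE.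
apply: (measurableT_comp (continuous_measurable_fun (@sqrt_continuous R))).
by apply: measurable_funD; apply: measurable_funX.
Qed.

Lemma L1normE (f : R -> R[i]) : L1norm f = (\int[mu]_x (normc (f x))%:E)%E.
Proof.
rewrite /L1norm Lnorm1; apply: eq_integral => x _.
by rewrite /= ger0_norm// normc_ge0.
Qed.

Lemma integral_indicM (A : set R) (h : R -> R) :
  (\int[mu]_x (\1_A x * h x)%:E = \int[mu]_(x in A) (h x)%:E)%E.
Proof.
rewrite [RHS]integral_mkcond; apply: eq_integral => x _.
by rewrite patchE indicE; case: (x \in A); rewrite ?mul1r ?mul0r.
Qed.

Lemma measurable_supp (n : R -> R[i]) : L1 n -> measurable (supp n).
Proof.
move=> [/measurable_real_fun mr /measurable_real_fun mi].
have -> : supp n = (fun x => normc (n x)) @^-1` (~` [set 0]).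
  apply/seteqP; split=> x /=; rewrite /supp /= => n0.
    by move=> /ComplexField.Normc.eq0_normc /eqP; apply/negP.
  by apply: contra_notN n0 => /eqP ->; rewrite normcE /= expr0n addr0 sqrtr0.
rewrite -[X in measurable X]setTI; apply: measurable_normc => //.
by apply: measurableC; exact: measurable_set1.
Qed.

Variables (tau delta : R) (G : R -> R[i]) (N : set R).
Hypotheses (tau0 : 0 < tau) (delta0 : 0 < delta).
Hypotheses (PW : paley_wiener1 tau G) (mN : measurable N).

Let V := cos_transform (trapezoid tau delta).
Let r x := normc (G x).
Let i1 : mu.-integrable setT (EFin \o (fun x => complex.Re (G x))). Proof. by case: PW => -[]. Qed.
Let i2 : mu.-integrable setT (EFin \o (fun x => complex.Im (G x))). Proof. by case: PW => -[]. Qed.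
Let mr : measurable_fun setT r.
Proof. by apply: measurable_normc; apply: measurable_real_fun. Qed.

Let r0 x : 0 <= r x. Proof. exact: normc_ge0. Qed.

Let ir : mu.-integrable setT (EFin \o r).
Proof.
apply: (le_integrable measurableT _ _
  (integrableD measurableT (integrable_norm i1) (integrable_norm i2))).
- exact/measurable_EFinP.
- move=> x _; rewrite /= lee_fin (ger0_norm (r0 x)) [leRHS]ger0_norm ?addr_ge0//.
  exact: normc_le.
Qed.

Let cV : continuous V.
Proof. exact: continuous_cos_transform (integrable_trapezoid tau delta). Qed.

Let cVB (x : R) : continuous (fun y : R => V (x - y)).
Proof.
move=> y; apply: (@continuous_comp _ _ _ (fun y => x - y) V); last exact: cV.
by apply: cvgB; [exact: cvg_cst|exact: cvg_id].
Qed.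

Let mVB (x : R) : measurable_fun setT (fun y : R => V (x - y)).
Proof. by apply: continuous_measurable_fun; exact: cVB. Qed.

Let V_le (x y : R) : `|V (x - y)| <= 2 * tau + delta^-1.
Proof. exact: cos_transform_trapezoid_le. Qed.

Let iconv (g : R -> R) (x : R) : mu.-integrable setT (EFin \o g) ->
  mu.-integrable setT (EFin \o (fun y => g y * V (x - y))).
Proof. by move=> ig; exact: integrable_mul_bounded ig (mVB x) (V_le x). Qed.

(** The reproducing identity holds for the real and imaginary parts separately. Combining them along
    the direction of G(x) recovers |G(x)| on the left and, by [normc_dual], at most |G(y)| under the
    integral. *)
Let pointwise : {ae mu, forall x, ((r x)%:E <= \int[mu]_y (r y * `|V (x - y)|)%:E)%E}.
Proof.
have rep1 : {ae mu, forall x, complex.Re (G x) = \int[mu]_y (complex.Re (G y) * V (x - y))}.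
  by apply: reproducing => // t /(paley_wiener_transforms PW)[].
have rep2 : {ae mu, forall x, complex.Im (G x) = \int[mu]_y (complex.Im (G y) * V (x - y))}.
  by apply: reproducing => // t /(paley_wiener_transforms PW)[].
apply: filterS2 rep1 rep2; first exact: (ae_filter_ringOfSetsType mu).
move=> x G1 G2; have [rx0|rx0] := eqVneq (r x) 0.
  by rewrite rx0; apply: integral_ge0 => y _; rewrite lee_fin mulr_ge0.
(* (u, v) is the unit vector in the direction of G(x). *)
pose u := complex.Re (G x) / r x; pose v := complex.Im (G x) / r x.
have r2 : r x ^+ 2 = complex.Re (G x) ^+ 2 + complex.Im (G x) ^+ 2.
  by rewrite /r normcE sqr_sqrtr// addr_ge0 ?sqr_ge0.
have uv : u ^+ 2 + v ^+ 2 = 1.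
  by rewrite /u /v !expr_div_n -mulrDl -r2 divff// expf_neq0.
have rE : r x = u * complex.Re (G x) + v * complex.Im (G x).
  by apply: (mulIf rx0); rewrite -expr2 r2 /u /v; field.
have iu g c : mu.-integrable setT (EFin \o g) ->
    mu.-integrable setT (EFin \o (fun y => c * (g y * V (x - y)))).
  by move=> ig; exact: (integrableZl measurableT c (iconv x ig)).
have irV : mu.-integrable setT (EFin \o (fun y => r y * `|V (x - y)|)).
  apply: (@integrable_mul_bounded _ _ _ (2 * tau + delta^-1) ir) => [|y].
    by apply: measurableT_comp => //; exact: mVB.
  by rewrite normr_id V_le.
have -> : (\int[mu]_y (r y * `|V (x - y)|)%:E)%E = (\int[mu]_y (r y * `|V (x - y)|))%:E.
  by rewrite /Rintegral fineK//; exact: integrable_fin_num irV.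
rewrite lee_fin rE [in leLHS]G1 [in leLHS]G2 -!RintegralZl//; try exact: iconv.
rewrite -RintegralD//; [|exact: iu|exact: iu].
apply: le_Rintegral => //.
  exact: (integrableD measurableT (iu _ u i1) (iu _ v i2)).
move=> y _; rewrite !mulrA -mulrDl (le_trans (ler_norm _))// normrM ler_wpM2r//.
exact: normc_dual.
Qed.

Let F (z : R * R) : \bar R := (\1_N z.1 * (r z.2 * `|V (z.1 - z.2)|))%:E.

Let F0 z : (0 <= F z)%E.
Proof. by rewrite lee_fin mulr_ge0 ?indicE// mulr_ge0. Qed.

Let mF : measurable_fun setT F.
Proof.
apply/measurable_EFinP; apply: measurable_funM.
  by apply: measurableT_comp measurable_fst; exact: measurable_indic.
apply: measurable_funM; first exact: measurableT_comp mr measurable_snd.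
apply: measurableT_comp => //.
apply: (measurableT_comp (continuous_measurable_fun cV)).
exact: measurable_funB.
Qed.

(** Integrate the pointwise bound over N and exchange the integrals by Tonelli; the inner integral
    of |V(x - y)| over N is then bounded uniformly in y by [window_integral]. *)
Lemma concentration :
  (\int[mu]_(x in N) (normc (G x))%:E
    <= (2 * tau + delta^-1 + 5 / 2 * delta^-1)%:E * window_density N delta *
       \int[mu]_x (normc (G x))%:E)%E.
Proof.
set C := 2 * tau + delta^-1; set W := window_density N delta.
have C0 : 0 <= C by rewrite addr_ge0 ?mulr_ge0 ?invr_ge0// ltW.
have dV0 : 0 <= delta^-1 by rewrite invr_ge0 ltW.
have W0 : (0 <= W)%E.
  apply: le_trans (measure_ge0 mu (N `&` `[0, 0 + delta])) _.
  by apply: ereal_sup_ubound; exists 0.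
rewrite -(integral_indicM N r).
apply: (@le_trans _ _ (\int[mu]_x \int[mu]_y F (x, y))%E).
  apply: ae_ge0_le_integral => //.
  - by move=> x _; rewrite lee_fin; apply: mulr_ge0; [rewrite indicE|exact: r0].
  - apply/measurable_EFinP; apply: measurable_funM => //; exact: measurable_indic.
  - by move=> x _; exact: integral_ge0.
  - exact: (@measurable_fun_fubini_tonelli_F _ _ _ _ _ mu F mF F0).
  apply: filterS pointwise; first exact: (ae_filter_ringOfSetsType mu).
  move=> x hx _; rewrite /F /= indicE; case: (x \in N).
    by rewrite mul1r; under eq_integral do rewrite mul1r.
  by rewrite mul0r; apply: integral_ge0 => y _; rewrite mul0r.
rewrite (@fubini_tonelli _ _ _ _ _ mu mu F mF F0).
rewrite -ge0_integralZl//; last 3 first.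
- exact/measurable_EFinP.
- by move=> x _; rewrite lee_fin normc_ge0.
- by rewrite mule_ge0// lee_fin addr_ge0// mulr_ge0.
apply: ge0_le_integral => //.
- by move=> y _; exact: integral_ge0.
- exact: (@measurable_fun_fubini_tonelli_G _ _ _ _ _ mu F mF F0).
- by apply: measurable_funeM; exact/measurable_EFinP.
move=> y _.
have -> : (\int[mu]_x F (x, y) = (r y)%:E * \int[mu]_(x in N) `|V (x - y)|%:E)%E.
  rewrite -(integral_indicM N (fun x => `|V (x - y)|)) -ge0_integralZl//.
  - by apply: eq_integral => x _; rewrite /F /= -EFinM mulrCA.
  - apply/measurable_EFinP; apply: measurable_funM; first exact: measurable_indic.
    apply: measurableT_comp => //; apply: (measurableT_comp (continuous_measurable_fun cV)).
    exact: measurable_funB.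
  - by rewrite lee_fin; exact: r0.
rewrite muleC lee_wpmul2r ?lee_fin//.
apply: window_integral => //.
- exact: cos_transform_trapezoid_le.
- exact: cos_transform_trapezoid_decay.
Qed.

End Concentration.

Theorem theorem1 (R : realType) :
  exists C : R -> R -> R,
    (forall tau delta : R, 0 < tau -> 0 < delta -> 0 < C tau delta) /\
    (* (a) *)
    (forall tau delta : R, 0 < tau -> 0 < delta ->
      forall n : R -> R[i], L1 n ->
      forall G : R -> R[i], paley_wiener1 tau G ->
      (L1norm (fun x => (G x * \1_(supp n) x)%R)
         <= (C tau delta)%:E * window_density (supp n) delta * L1norm G)%E) /\
    (* (b) *)
    (forall tau delta : R, 0 < tau -> 0 < delta ->
      C tau delta <= 80 / 13 * (tau + delta^-1)) /\
    (* (c) *)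
    (forall tau delta : R, 0 < tau -> 0 < delta -> 2 <= tau * delta ->
      C tau delta <= 5 / 2 * (tau + delta^-1)) /\
    (* (d) *)
    (forall eps : R, 0 < eps ->
      exists r : R, forall tau delta : R, 0 < tau -> 0 < delta ->
        r < tau * delta -> `|C tau delta / (tau + delta^-1) - 2| < eps).
Proof.
(* The first two terms are the uniform bound on V, paid in the central window; the last one is the
   total cost of the other windows. *)
exists (fun tau delta => 2 * tau + delta^-1 + 5 / 2 * delta^-1).
have dV (delta : R) : 0 < delta -> 0 < delta^-1 by rewrite invr_gt0.
split; first by move=> tau delta t0 /dV d0; lra.
split.
  move=> tau delta t0 d0 n Ln G PW; rewrite !L1normE.
  have := concentration t0 d0 PW (measurable_supp Ln); rewrite -integral_indicM.
  apply: le_trans; rewrite le_eqVlt; apply/orP; left; apply/eqP.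
  apply: eq_integral => x _; congr EFin; rewrite !indicE; case: (x \in _).
    by rewrite mulr1 mul1r.
  by rewrite mulr0 mul0r normcE /= expr0n addr0 sqrtr0.
split; first by move=> tau delta t0 /dV d0; lra.
split.
  move=> tau delta t0 d0 td.
  (* The claim rearranges to 1/delta <= tau/2. *)
  have : 2 * delta^-1 <= tau by rewrite ler_pdivrMr.
  lra.
(* The quotient minus 2 is exactly (3/2) / (tau delta + 1), which dictates the threshold. *)
move=> eps e0; exists (3 / 2 / eps) => tau delta t0 d0.
rewrite ltr_pdivrMr// => td.
have s0 : 0 < tau + delta^-1 by rewrite addr_gt0// dV.
rewrite (_ : _ - 2 = 3 / 2 / (tau * delta + 1)); last first.
  by field; rewrite !gt_eqF// addr_gt0// mulr_gt0.
have p0 : 0 < tau * delta + 1 by rewrite addr_gt0// mulr_gt0.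
rewrite gtr0_norm ?divr_gt0// ltr_pdivrMr//.
by rewrite mulrDr mulr1 [eps * _]mulrC; lra.
Qed.
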